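(* Let $X$ be a complex Banach space which possesses the UMD property. Then there is a constant $C$, depending only on the space $X$, such that for every $X$-valued measure $\mu$ on $\mathbb R$ with finite total variation, the non-tangential maximal function $T^<\mu$ of the Cauchy transform of $\mu$ belongs to the weak class $L^{1,\infty}(\mathbb R)$ and the estimate $$\sup_{s>0}\ s\,\bigl|\{\lambda\in\mathbb R:\ (T^<\mu)(\lambda)>s\}\bigr|\le C\,\|\mu\|(\mathbb R)$$ holds true.
   Context: $\|\cdot\|$ is the norm of $X$ and $|A|$ is the Lebesgue measure of a set $A\subset\mathbb R$. An $X$-valued measure on $\mathbb R$ is a countably additive (with convergence in the norm of $X$) map from the Borel subsets of $\mathbb R$ to $X$. Its total variation is $\|\mu\|(\mathbb R)=\sup\sum_n\|\mu(\delta_n)\|$, the supremum being over all finite collections of disjoint intervals $\delta_n\subset\mathbb R$. UMD property: the Hilbert transform $Hf(x)=\lim_{r\to0+}\int_{|x-y|>r}\frac{f(y)}{y-x}\,dy$ is bounded in $L^2(\mathbb R,X)$, i.e. $\int_{\mathbb R}\|Hf(x)\|^2dx\le C_X\int_{\mathbb R}\|f(x)\|^2dx$ for all $f\in L^2(\mathbb R,X)$, with some constant $C_X$. The Cauchy transform of $\mu$ is $\mathcal C\mu(z)=\int_{\mathbb R}\frac{d\mu(t)}{t-z}$, $\operatorname{Im}z>0$, and $$(T^<\mu)(\lambda)=\sup\{\|\mathcal C\mu(x+iy)\|:\ y>0,\ |x-\lambda|<y\}.$$ The weak class $L^{1,\infty}(\mathbb R)$ consists of the functions $f$ with $\sup_{t>0}t\,|\{x\in\mathbb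 R:|f(x)|>t\}|<\infty$. *)

(* Defs.v *)
From HB Require Import structures.
From mathcomp Require Import all_boot all_order all_algebra.
From mathcomp Require Import complex.
From mathcomp Require Import all_classical all_reals all_analysis.
From mathcomp Require Import measurable_realfun.

Set Implicit Arguments.
Unset Strict Implicit.
Unset Printing Implicit Defensive.

Import Order.TTheory GRing.Theory Num.Theory.
Import numFieldNormedType.Exports.

Local Open Scope classical_set_scope.
Local Open Scope ring_scope.
Local Open Scope complex_scope.

(* The norm of a normed module over R[i] takes its values in R[i], where it is a
   nonnegative real; rnorm is that norm as an element of R. *)
Definition rnorm (R : realType) (V : normedZmodType R[i]) (v : V) : R :=
  complex.Re `|v|.

Section simple_functions.
Context d (T : measurableType d) (V : Type).

Definition simple_fun (s : T -> V) : Prop :=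
  finite_set (range s) /\ forall v : V, measurable (s @^-1` [set v]).

End simple_functions.

Section bochner.
Context (R : realType) (X : completeNormedModType R[i]).
Context d (T : measurableType d) (m : {measure set T -> \bar R}).

Definition integrable_simple_fun (s : T -> X) : Prop :=
  simple_fun s /\ forall v : X, v != 0 -> (m (s @^-1` [set v]) < +oo)%E.

(* Only finitely many terms are nonzero when s is an integrable simple function;
   the (possibly infinite) measure of the set where s vanishes has weight 0. *)
Definition simple_integral (s : T -> X) : X :=
  \sum_(v \in [set: X]) (fine (m (s @^-1` [set v])))%:C *: v.

Definition strongly_measurable (f : T -> X) : Prop :=
  exists s : nat -> T -> X, (forall n, simple_fun (s n)) /\
    {ae m, forall x, s n x @[n --> \oo] --> f x}.

Definition is_bochner_integral (f : T -> X) (v : X) : Prop :=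
  exists s : nat -> T -> X,
    [/\ forall n, integrable_simple_fun (s n),
        {ae m, forall x, s n x @[n --> \oo] --> f x},
        (\int[m]_x (rnorm (s n x - f x))%:E)%E @[n --> \oo] --> 0%E &
        simple_integral (s n) @[n --> \oo] --> v].

Definition bochner_integral (f : T -> X) : X :=
  get [set v | is_bochner_integral f v].

Definition sqr_norm_integral (f : T -> X) : \bar R :=
  (\int[m]_x (rnorm (f x) ^+ 2)%:E)%E.

Definition L2 (f : T -> X) : Prop :=
  strongly_measurable f /\ (sqr_norm_integral f < +oo)%E.

End bochner.

Section UMD.
Context (R : realType) (X : completeNormedModType R[i]).
Notation leb := (@lebesgue_measure R).

Definition truncated_hilbert (f : measurableTypeR R -> X) (x r : R) : X :=
  bochner_integral leb
    (fun y => if r < `|x - y| then ((y - x)^-1)%:C *: f y else 0).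

Definition hilbert_transform (f : measurableTypeR R -> X) (x : measurableTypeR R)
    : X :=
  lim (truncated_hilbert f x r @[r --> 0^'+]).

(* lim is arbitrary when there is no limit, so boundedness in L^2 must include
   the almost everywhere existence of the principal value. *)
Definition UMD : Prop :=
  exists C : R, forall f : measurableTypeR R -> X, L2 leb f ->
    {ae leb, forall x, cvg (truncated_hilbert f x r @[r --> 0^'+])} /\
    (sqr_norm_integral leb (hilbert_transform f)
       <= C%:E * sqr_norm_integral leb f)%E.

End UMD.

Section vector_measures.
Context (R : realType) (X : completeNormedModType R[i]).

(* The values of mu outside the Borel sets are irrelevant. *)
Definition vector_measure (mu : set (measurableTypeR R) -> X) : Prop :=
  forall F : nat -> set (measurableTypeR R),
    (forall n, measurable (F n)) -> trivIset setT F ->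
    (\sum_(0 <= i < n) mu (F i)) @[n --> \oo] --> mu (\bigcup_n F n).

Definition measure_variation (mu : set (measurableTypeR R) -> X) : \bar R :=
  ereal_sup [set t | exists (n : nat) (delta : 'I_n -> set R),
    [/\ forall i, is_interval (delta i),
        trivIset setT delta &
        t = (\sum_(i < n) rnorm (mu (delta i)))%:E]].

Definition simple_vintegral (mu : set (measurableTypeR R) -> X)
    (s : measurableTypeR R -> R[i]) : X :=
  \sum_(c \in [set: R[i]]) c *: mu (s @^-1` [set c]).

(* Integral of a bounded Borel scalar function against a vector measure of
   bounded variation, through uniform approximation by simple functions. *)
Definition is_vintegral (mu : set (measurableTypeR R) -> X)
    (f : measurableTypeR R -> R[i]) (v : X) : Prop :=
  exists s : nat -> measurableTypeR R -> R[i],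
    [/\ forall n, simple_fun (s n),
        forall e : R, 0 < e -> \forall n \near \oo,
          forall t, rnorm (s n t - f t) < e &
        simple_vintegral mu (s n) @[n --> \oo] --> v].

Definition vintegral (mu : set (measurableTypeR R) -> X)
    (f : measurableTypeR R -> R[i]) : X :=
  get [set v | is_vintegral mu f v].

Definition cauchy_transform (mu : set (measurableTypeR R) -> X) (z : R[i]) : X :=
  vintegral mu (fun t => (t%:C - z)^-1).

Definition nontangential_max (mu : set (measurableTypeR R) -> X)
    (lambda : measurableTypeR R) : \bar R :=
  ereal_sup [set t | exists x y : R,
    [/\ 0 < y, `|x - lambda| < y &
        t = (rnorm (cauchy_transform mu (x +i* y)))%:E]].

End vector_measures.

Definition weak_L1 (R : realType) (f : measurableTypeR R -> \bar R) : Prop :=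
  measurable_fun setT f /\
  (ereal_sup [set (t%:E * lebesgue_measure [set x | t%:E < `|f x|])%E
             | t in [set t : R | (0 < t)%R]] < +oo)%E.

(* Main.v *)
Require Import Defs.
From mathcomp Require Import all_boot all_order all_algebra.
From mathcomp Require Import complex ring lra.
From mathcomp Require Import all_classical all_reals all_analysis.
From mathcomp Require Import measurable_realfun.

(** The proof is the Calderon-Zygmund argument for weak-type bounds, arranged so
    that the UMD property is used for step functions only.

    Reduction to point masses. On a fine grid, the Cauchy transform of mu at a
    point z of the upper half-plane is the limit of the sums of mu(cell) times
    1/(t - z) with t in the cell ([cauchy_transform_grid]), and the norms of the
    mu(cell) add up to at most the variation. The sets on which the non-tangential
    maximal function exceeds a level are open unions of intervals, and a
    point where it exceeds the level for mu has this property for all fine enough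
    grids. So it is enough to bound, uniformly, the sums of finitely many vectors
    a_k placed at points t_k, with masses m_k >= |a_k| of total M.

    Clusters. For a level s, group the points into clusters lying in disjoint
    intervals whose lengths are the masses of the clusters divided by s
    ([disjoint_clusters]). Replacing the point masses of a cluster by a uniform
    density on its interval gives a step function g with norm at most s, supported
    on a set of measure M/s. The Hilbert transform of a step function is an explicit
    combination of logarithms ([hilbert_transform_step]); the UMD property bounds
    the square of its L^2 norm by C s M.

    Comparison. Let lam be outside the doubled intervals, |x - lam| < y and
    |w - lam| < y. Then the Cauchy transform of the point masses at x + i y differs
    from the Hilbert transform at w of the far part of g, carried by the clusters
    that start at distance at least 4 y from lam, by O(s) plus a function of lam
    whose integral is O(M) ([rnorm_cauchy_sum_le]). Indeed the near clusters have
    total length O(y), hence mass O(s y), while each kernel is at most 1/y; for a far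
    cluster of length L at distance D the two kernels differ by O((L + y)/D^2), and
    the disjointness of the intervals bounds the sum of the terms in y by an integral
    of y/u^2 beyond distance of order y.

    Conclusion. The inequality may be averaged over all w with |w - lam| < y. The
    Hilbert transform of the near part of g has average square O(s^2) there, again
    by the L^2 bound. So at a point lam where the maximal function of the
    Cauchy transform exceeds a suitable multiple of s, either lam is in a doubled
    interval, or the integrable error exceeds s, or the Hardy-Littlewood maximal
    function of the squared norm of the Hilbert transform of g exceeds 2 s^2
    ([cauchy_sum_HL_maximal]). All three sets have measure O(M/s), the last one by
    the maximal inequality. *)

Set Implicit Arguments.
Unset Strict Implicit.
Unset Printing Implicit Defensive.

Import Order.TTheory GRing.Theory Num.Theory.
Import numFieldNormedType.Exports.

Local Open Scope classical_set_scope.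
Local Open Scope ring_scope.
Local Open Scope complex_scope.

(** * The real-valued norm *)

Section rnorm_theory.
Context {R : realType} {V : normedModType R[i]}.
Implicit Types (v w : V) (c : R[i]).

Lemma rnormE v : `|v| = (rnorm v)%:C.
Proof. by rewrite /rnorm RRe_real// realE normr_ge0. Qed.

Lemma rnorm_ge0 v : 0 <= rnorm v.
Proof. by rewrite -lecR -rnormE normr_ge0. Qed.

Lemma rnorm0 : rnorm (0 : V) = 0.
Proof. by rewrite /rnorm normr0. Qed.

Lemma rnormD v w : rnorm (v + w) <= rnorm v + rnorm w.
Proof. by rewrite -lecR rmorphD/= -!rnormE ler_normD. Qed.

Lemma rnormN v : rnorm (- v) = rnorm v.
Proof. by rewrite /rnorm normrN. Qed.

Lemma rnormB v w : rnorm (v - w) <= rnorm v + rnorm w.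
Proof. by rewrite -(rnormN w) rnormD. Qed.

Lemma rnormBC v w : rnorm (v - w) = rnorm (w - v).
Proof. by rewrite -rnormN opprB. Qed.

Lemma rnormZ c v : rnorm (c *: v) = rnorm c * rnorm v.
Proof.
apply: complexI; rewrite rmorphM/= -!rnormE normrZ.
by congr (_ * _); rewrite /rnorm RRe_real// realE normr_ge0.
Qed.

Lemma rnorm_sum (I : Type) (r : seq I) (P : pred I) (F : I -> V) :
  rnorm (\sum_(i <- r | P i) F i) <= \sum_(i <- r | P i) rnorm (F i).
Proof.
elim/big_rec2 : _ => [|i y x _ h]; first by rewrite rnorm0.
by rewrite (le_trans (rnormD _ _))// lerD2l.
Qed.

Lemma rnorm_eq0 v : rnorm v = 0 -> v = 0.
Proof. by move=> h; apply/normr0_eq0; rewrite rnormE h. Qed.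

Lemma dist_rnorm v w : `|rnorm v - rnorm w| <= rnorm (v - w).
Proof.
rewrite ler_norml; apply/andP; split.
  rewrite lerBrDr addrC lerBlDr addrC rnormBC.
  by rewrite -[X in rnorm X <= _](subrK v w) (le_trans (rnormD _ _)) // lerD2r.
by rewrite lerBlDr -[X in rnorm X <= _](subrK w v) rnormD.
Qed.

Lemma cvg_rnormP {T : Type} {F : set_system T} {FF : Filter F} (f : T -> V) v :
  f @ F --> v <-> forall e : R, 0 < e -> \forall t \near F, rnorm (v - f t) < e.
Proof.
split=> [/cvgrPdist_lt fv e e0|fv].
  have /fv : 0 < e%:C by rewrite ltcR.
  by apply: filterS => t; rewrite rnormE ltcR.
apply/cvgrPdist_lt => e e0.
have er : e = (complex.Re e)%:C by rewrite RRe_real// realE ltW.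
rewrite er ltcR in e0.
by apply: filterS (fv _ e0) => t; rewrite er rnormE ltcR.
Qed.

Lemma cvg_rnorm {T : Type} {F : set_system T} {FF : Filter F} (f : T -> V) v :
  f @ F --> v -> rnorm (f t) @[t --> F] --> rnorm v.
Proof.
move=> /cvg_rnormP fv; apply/cvgrPdist_lt => e e0.
by apply: filterS (fv _ e0) => t /=; apply: le_lt_trans; exact: dist_rnorm.
Qed.

End rnorm_theory.

Section rnorm_complex.
Context {R : realType}.
Implicit Types z : R[i].

Lemma rnormCM (z w : R[i]) : rnorm (z * w) = rnorm z * rnorm w.
Proof. exact: (@rnormZ R R[i]^o). Qed.

Lemma rnormV z : rnorm z^-1 = (rnorm z)^-1.
Proof.
apply: complexI; rewrite fmorphV/= -!(@rnormE R R[i]^o).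
exact: normfV.
Qed.

Lemma rnorm_real (x : R) : rnorm (x%:C : R[i]) = `|x|.
Proof. by rewrite /rnorm normc_def /= expr0n/= addr0 sqrtr_sqr. Qed.

Lemma rnorm_ge_Re z : `|complex.Re z| <= rnorm z.
Proof. by rewrite -lecR -(@rnormE R R[i]^o); exact: normc_ge_Re. Qed.

Lemma rnorm_ge_Im z : `|complex.Im z| <= rnorm z.
Proof.
rewrite /rnorm normc_def /= -sqrtr_sqr ler_wsqrtr// lerDr sqr_ge0 //.
Qed.

Lemma rnorm_le_ReIm z : rnorm z <= `|complex.Re z| + `|complex.Im z|.
Proof.
case: z => a b; have -> : a +i* b = a%:C + 'i%C * b%:C :> R[i].
  by rewrite [LHS]complexE.
rewrite (le_trans (@rnormD R R[i]^o _ _))// rnormCM !rnorm_real /=.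
rewrite !(mul0r,mul1r,subr0,addr0,add0r,mulr0).
rewrite lerD2l ler_piMl//.
by rewrite /rnorm normc_def/= expr0n expr1n add0r sqrtr1.
Qed.

End rnorm_complex.

Section cvg_combination.
Context {R : realType} {V : normedModType R[i]}.

Lemma cvg_combination {T : Type} {F : set_system T} {FF : Filter F}
    (I : Type) (r : seq I) (a : I -> T -> R) (l : I -> R) (v : I -> V) :
    (forall i, a i t @[t --> F] --> l i) ->
  \sum_(i <- r) (a i t)%:C *: v i @[t --> F] --> \sum_(i <- r) (l i)%:C *: v i.
Proof.
move=> al; elim: r => [|i r IH].
  by rewrite big_nil; under eq_fun do rewrite big_nil; exact: cvg_cst.
rewrite big_cons; under eq_fun do rewrite big_cons.
apply: cvgD => //; apply/cvg_rnormP => e e0.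
have ev : 0 < e / (rnorm (v i) + 1) by rewrite divr_gt0// ltr_wpDl// rnorm_ge0.
have := al i => /cvgrPdist_lt/(_ _ ev); apply: filterS => t h.
rewrite -scalerBl -rmorphB rnormZ rnorm_real.
apply: (@le_lt_trans _ _ (`|l i - a i t| * (rnorm (v i) + 1))).
  by rewrite ler_wpM2l// lerDl.
by rewrite -ltr_pdivlMr// ltr_wpDl// rnorm_ge0.
Qed.

End cvg_combination.

(** * Simple functions and vector measures *)

Section finite_additivity.
Context d (T : measurableType d) (W : nmodType).

Definition finitely_additive (nu : set T -> W) :=
  nu set0 = 0 /\ forall A B, measurable A -> measurable B -> A `&` B = set0 ->
    nu (A `|` B) = nu A + nu B.

Lemma finitely_additive_bigsetU (nu : set T -> W) (I : choiceType) (s : seq I)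
    (F : I -> set T) : finitely_additive nu -> uniq s ->
    (forall i, measurable (F i)) ->
    {in s &, forall i j, i != j -> F i `&` F j = set0} ->
  nu (\big[setU/set0]_(i <- s) F i) = \sum_(i <- s) nu (F i).
Proof.
move=> [nu0 nuU] + mF; elim: s => [|i s IH] /=; first by rewrite !big_nil.
move=> /andP[nis us] disj; rewrite !big_cons nuU ?IH//.
- by move=> j k js ks; apply: disj; rewrite inE (js,ks) orbT.
- by apply: bigsetU_measurable.
rewrite -bigcup_seq setI_bigcupr bigcup0// => j /= js.
apply: disj; rewrite ?inE ?eqxx ?js ?orbT//.
by apply: contraNneq nis => ->.
Qed.

Lemma finitely_additive_fibers (nu : set T -> W) (Q : finType) (p : T -> Q)
    (P : pred Q) : finitely_additive nu ->
    (forall q, measurable (p @^-1` [set q])) ->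
  nu (p @^-1` [set q | P q]) = \sum_(q | P q) nu (p @^-1` [set q]).
Proof.
move=> nuA mp; rewrite -big_filter -finitely_additive_bigsetU//.
- congr nu; rewrite -bigcup_seq; apply/seteqP; split => [t /= Pt|t [q /=]].
    by exists (p t) => //=; rewrite mem_filter Pt mem_index_enum.
  by rewrite mem_filter => /andP[Pq _] ->.
- by rewrite filter_uniq// index_enum_uniq.
- move=> i j _ _ ij; apply/seteqP; split => // t [/= ti tj].
  by move: ij; rewrite -ti -tj eqxx.
Qed.

End finite_additivity.

Section simple_function_sums.
Context d (T : measurableType d).

(** The sums defining integrals of simple functions run over the values of
    the function; this rewrites them as sums over any finite measurable
    partition on whose cells the function is constant. *)
Lemma sum_over_values (V : choiceType) (W : nmodType) (Q : finType)
    (p : T -> Q) (phi : Q -> V) (B : V -> set T -> W) :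
    (forall v, B v set0 = 0) ->
    (forall v, B v (p @^-1` [set q | phi q == v])
               = \sum_(q | phi q == v) B v (p @^-1` [set q])) ->
  \sum_(v \in [set: V]) B v ((phi \o p) @^-1` [set v])
  = \sum_q B (phi q) (p @^-1` [set q]).
Proof.
move=> B0 BD.
have E v : (phi \o p) @^-1` [set v] = p @^-1` [set q | phi q == v].
  by apply/seteqP; split => t /=; [move=> ->|move=> /eqP].
rewrite (fsbigE (undup (codom phi))) ?undup_uniq//; last first.
  move=> v _; rewrite mem_undup => vphi.
  rewrite E (_ : _ @^-1` _ = set0) ?B0//; apply/seteqP; split => // t /= /eqP tv.
  by move/negP: vphi; apply; rewrite -tv codom_f.
rewrite (eq_bigl xpredT); last by move=> v; rewrite mem_set.
under eq_bigr do rewrite E BD.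
rewrite (exchange_big_dep xpredT)//=; apply: eq_bigr => q _.
under eq_bigl do rewrite eq_sym.
by rewrite -big_filter filter_pred1_uniq ?undup_uniq ?mem_undup ?codom_f// big_seq1.
Qed.

Lemma simple_fun_fibers (V : eqType) (s : T -> V) : simple_fun s ->
  exists (n : nat) (p : T -> 'I_n.+1) (phi : 'I_n.+1 -> V),
    s = phi \o p /\ forall q, measurable (p @^-1` [set q]).
Proof.
move=> [/finite_seqP[r rE] ms].
have [n [r' [sr' ur' rs]]] : exists n (r' : seq V),
    [/\ size r' = n.+1, uniq r' & forall t, s t \in r'].
  have sr t : s t \in undup r.
    by rewrite mem_undup; have : range s (s t) by []; rewrite rE.
  exists (size (undup r)).-1, (undup r); split; rewrite ?undup_uniq//.
  by have := sr point; case: (undup r).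
have ltn t : (index (s t) r' < n.+1)%N by rewrite -sr' index_mem.
exists n, (fun t => Ordinal (ltn t)), (fun i => nth (s point) r' i).
split; first by apply/funext => t /=; rewrite nth_index.
move=> q; rewrite (_ : _ @^-1` _ = s @^-1` [set nth (s point) r' q])//.
apply/seteqP; split => t /= tq; first by rewrite -tq /= nth_index.
by apply/val_inj => /=; rewrite tq index_uniq// sr'.
Qed.

Lemma simple_fun_comp (V : eqType) (Q : finType) (p : T -> Q) (phi : Q -> V) :
  (forall q, measurable (p @^-1` [set q])) -> simple_fun (phi \o p).
Proof.
move=> mp; split.
  apply: (@sub_finite_set _ _ [set` codom phi]); last exact: finite_seq.
  by move=> _ [t _ <-] /=; exact: codom_f.
move=> v; rewrite (_ : _ @^-1` _ = \big[setU/set0]_(q | phi q == v) p @^-1` [set q]).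
  by apply: bigsetU_measurable.
rewrite -bigcup_seq_cond; apply/seteqP; split => t /=.
  by move=> tv; exists (p t) => //=; rewrite mem_index_enum tv eqxx.
by move=> [q /= /andP[_ /eqP <-] ->].
Qed.

Lemma measurable_pair_fiber (Q Q' : finType) (p : T -> Q) (p' : T -> Q') :
  (forall q, measurable (p @^-1` [set q])) ->
  (forall q, measurable (p' @^-1` [set q])) ->
  forall q, measurable ((fun t => (p t, p' t)) @^-1` [set q]).
Proof.
move=> mp mp' [q q']; rewrite (_ : _ @^-1` _ = p @^-1` [set q] `&` p' @^-1` [set q']).
  exact: measurableI.
by apply/seteqP; split => t /=; [move=> [-> ->]|move=> [-> ->]].
Qed.

End simple_function_sums.

Section vector_measure_theory.
Context {R : realType} {X : completeNormedModType R[i]}.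
Variable mu : set (measurableTypeR R) -> X.
Hypothesis muV : vector_measure mu.

(** Countable additivity is only assumed for series, so the value on the empty
    set is the difference of two consecutive partial sums of a convergent
    constant series. *)
Lemma vector_measure0 : mu set0 = 0.
Proof.
have /(_ (fun=> set0)) := muV; rewrite bigcup0//.
move=> mu0; have {}mu0 : (\sum_(0 <= i < n) mu set0) @[n --> \oo] --> mu set0.
  by apply: mu0 => // ? ? _ _ [? []].
have muS : (\sum_(0 <= i < n.+1) mu set0) @[n --> \oo] --> mu set0.
  by apply/cvg_rnormP => e e0; have /cvg_rnormP/(_ e e0) [N _ H] := mu0;
    exists N => // n Nn; apply: H => /=; rewrite (leq_trans Nn).
have : (\sum_(0 <= i < n.+1) mu set0) - (\sum_(0 <= i < n) mu set0) @[n --> \oo] --> mu set0 - mu set0.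
  exact: cvgB muS mu0.
rewrite subrr.
have -> : (fun n => (\sum_(0 <= i < n.+1) mu set0) - (\sum_(0 <= i < n) mu set0))
    = (fun=> mu set0) :> (nat -> X).
  by apply/funext => n /=; rewrite big_nat_recr//= addrAC subrr add0r.
by move=> c0; apply: (cvg_unique _ _ c0) => //; exact: cvg_cst.
Qed.

Lemma vector_measure_additive : finitely_additive mu.
Proof.
split=> [|A B mA mB AB]; first exact: vector_measure0.
pose F (n : nat) : set (measurableTypeR R) := match n with 0 => A | 1 => B | _ => set0 end.
have tF : trivIset setT F.
  by move=> [|[|i]] [|[|j]] _ _ //= [t]; rewrite ?(set0I,setI0,AB) // setIC AB.
have := muV (F := F).
have -> : \bigcup_n F n = A `|` B.
  apply/seteqP; split => t; first by move=> [[|[|n]] _ //= ?]; [left|right].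
  by move=> [tA|tB]; [exists 0|exists 1].
have mF n : measurable (F n) by case: n => [|[|n]] /=; [exact: mA|exact: mB|exact: measurable0].
move=> /(_ mF tF) muF; apply: (cvg_unique _ muF) => //.
apply/cvg_rnormP => e e0; exists 2%N => // n /= n2.
rewrite (_ : \sum_(0 <= i < n) _ = mu A + mu B) ?subrr ?rnorm0//.
rewrite (@big_cat_nat _ _ _ 2%N)//= [X in _ + X]big_nat_cond.
rewrite [X in _ + X]big1 ?addr0.
  by rewrite !big_nat_recl//= big_geq// addr0.
by move=> [|[|i]]//= _; rewrite vector_measure0.
Qed.

Lemma vector_measureD (A B : set (measurableTypeR R)) :
  measurable A -> measurable B -> B `<=` A -> mu (A `\` B) = mu A - mu B.
Proof.
move=> mA mB BA; rewrite -{2}(setDUK BA) vector_measure_additive.2 ?setDIK//.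
  by rewrite addrAC subrr add0r.
exact: measurableD.
Qed.

Lemma vector_measure_nondecreasing (F : (set (measurableTypeR R))^nat) :
  (forall n, measurable (F n)) -> nondecreasing_seq F ->
  mu (F n) @[n --> \oo] --> mu (\bigcup_n F n).
Proof.
move=> mF ndF; rewrite -eq_bigcup_seqD.
have mD n : measurable (seqD F n) by case: n => [|n] /=; [|apply: measurableD].
have := muV mD (trivIset_seqD ndF).
have E n : \sum_(0 <= i < n.+1) mu (seqD F i) = mu (F n).
  rewrite big_mkord -(nondecreasing_bigsetU_seqD n ndF).
  rewrite finitely_additive_bigsetU ?index_enum_uniq//; first exact: vector_measure_additive.
  move=> i j _ _ ij; apply/eqP/negPn/negP => /set0P.
  by move/(trivIset_seqD ndF I I)/val_inj/eqP; rewrite (negbTE ij).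
move=> /cvg_rnormP cF; apply/cvg_rnormP => e e0.
have [N _ H] := cF _ e0; exists N => // n /= Nn.
by rewrite -E; apply: H => /=; rewrite (leq_trans Nn).
Qed.

Lemma vector_measure_nonincreasing (F : (set (measurableTypeR R))^nat) :
  (forall n, measurable (F n)) -> nonincreasing_seq F ->
  mu (F n) @[n --> \oo] --> mu (\bigcap_n F n).
Proof.
move=> mF niF.
have F0 n : F n `<=` F 0 by apply/subsetPset/niF.
have H : mu (F 0 `\` F n) @[n --> \oo] --> mu (\bigcup_n (F 0 `\` F n)).
  apply: vector_measure_nondecreasing => [n|m n mn]; first exact: measurableD.
  by rewrite subsetEset; apply: setDS; rewrite -subsetEset; exact: niF.
have mI : measurable (\bigcap_n F n) by exact: bigcapT_measurable.
have E : \bigcup_n (F 0 `\` F n) = F 0 `\` \bigcap_n F n.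
  by rewrite setDE setC_bigcap setI_bigcupr; apply: eq_bigcupr => n _; rewrite setDE.
move: H; rewrite E vector_measureD//; last by move=> t; apply.
move=> /cvg_rnormP H; apply/cvg_rnormP => e e0.
apply: filterS (H _ e0) => n /=; rewrite vector_measureD//.
by rewrite rnormBC !opprD !opprK addrACA subrr add0r addrC.
Qed.

(** Norm bounds survive monotone limits, so the bound by the interval variation
    passes from finite unions of half-open intervals to all Borel sets. *)
Lemma rnorm_vector_measure_le (M : R) :
    (measure_variation mu <= M%:E)%E ->
  forall A, measurable A -> rnorm (mu A) <= M.
Proof.
move=> varM.
pose G := [set A : set (measurableTypeR R) | measurable A /\ rnorm (mu A) <= M].
(* The closed ball of radius M is stable under limits: G is a monotone class. *)
have closedM (u : nat -> X) v : (forall n, rnorm (u n) <= M) -> u n @[n --> \oo] --> v ->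
    rnorm v <= M.
  move=> uM /cvg_rnorm uv; apply: (cvgr_to_le uv).
  by apply: nearW => n.
have mG : monotone G.
  split=> F nF GF.
    have mF n : measurable (F n) by have [] := GF n.
    split; first exact: bigcupT_measurable.
    apply: (closedM (mu \o F)); last exact: vector_measure_nondecreasing.
    by move=> n; have [] := GF n.
  have mF n : measurable (F n) by have [] := GF n.
  split; first exact: bigcapT_measurable.
  apply: (closedM (mu \o F)); last exact: vector_measure_nonincreasing.
  by move=> n; have [] := GF n.
(* The ring consists of finite disjoint unions of half-open intervals, on which
   the bound is one of the sums defining the variation. *)
have ringG : <<r R.-ocitv.-measurable >> `<=` G.
  move=> A rA.
  have mA : @measurable _ (measure_function.SetRing.type (ocitv_type R)) A by exact: rA.
  have [B [finB _ tB mB ->]] := measure_function.SetRing.ring_finite_set mA.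
  have {}mB Y : B Y -> R.-ocitv.-measurable Y by move=> BY; apply: mB; rewrite inE.
  have mB' Y : B Y -> @measurable _ (measurableTypeR R) Y.
    by move=> BY; apply: sub_sigma_algebra; exact: mB.
  split; first by apply: fin_bigcup_measurable.
  have /finite_seqP[s sB] := finB.
  pose s' := undup s.
  have s'B Y : Y \in s' -> B Y by rewrite mem_undup sB.
  have -> : \bigcup_(Y in B) Y = \big[setU/set0]_(i < size s') nth set0 s' i.
    rewrite -(big_mkord xpredT (fun i => nth set0 s' i)) -(big_nth set0 xpredT id) -bigcup_seq.
    by rewrite (_ : [set` s'] = B)// sB; apply/seteqP; split => Y /=; rewrite mem_undup.
  have ts' : trivIset setT (fun i : 'I_(size s') => nth set0 s' i).
    move=> i j _ _ ij; apply/val_inj/eqP; rewrite -(nth_uniq set0 (ltn_ord i) (ltn_ord j) (undup_uniq _)); apply/eqP.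
    by apply: tB => //; apply: s'B; rewrite mem_nth.
  rewrite finitely_additive_bigsetU ?index_enum_uniq//; last 3 first.
  - exact: vector_measure_additive.
  - by move=> i; exact: (mB' _ (s'B _ (mem_nth _ (ltn_ord i)))).
  - move=> i j _ _ ij; apply/eqP/negPn/negP => /set0P.
    by move/(ts' _ _ I I)/eqP; rewrite (negbTE ij).
  rewrite (le_trans (rnorm_sum _ _ _))// -lee_fin (le_trans _ varM)//.
  apply: ereal_sup_ubound; exists (size s'), (fun i => nth set0 s' i); split => // i.
  have /mB[[a b] _ <-] : B (nth set0 s' i) by exact: (s'B _ (mem_nth _ (ltn_ord i))).
  exact: interval_is_interval.
set K := <<r R.-ocitv.-measurable >> in ringG.
have srG : <<sr K >> `<=` G.
  by apply: (monotone_setring_sub_g_sigma_ring mG _ ringG); exact: smallest_setring.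
have ocitvK : R.-ocitv.-measurable `<=` <<sr K >>.
  by move=> Y oY; apply: sub_g_sigma_ring; exact: sub_setring.
have [sr0 srD srU] := smallest_sigma_ring K.
(* The real line is a countable union of bounded intervals, so the sigma-ring
   is a sigma-algebra. *)
have srT : <<sr K >> setT.
  rewrite -(bigcup_itvT false false); apply: srU => n; apply: ocitvK; exact: is_ocitv.
move=> A mA; apply: (proj2 (srG A _)); apply: mA; split => //.
by split => // B; apply: srD.
Qed.

End vector_measure_theory.

(** * Integration against a vector measure over a grid *)

Section subset_sums.
Context {R : realType} {X : normedModType R[i]} (Q : finType).
Implicit Types (x : Q -> X) (M : R).

(** The combination is affine in each coefficient, so its norm is largest when
    every coefficient is 0 or 1. *)
Lemma rnorm_convex_sum_le x M (c : Q -> R) :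
    (forall S : pred Q, rnorm (\sum_(q | S q) x q) <= M) ->
    (forall q, 0 <= c q <= 1) ->
  rnorm (\sum_q (c q)%:C *: x q) <= M.
Proof.
move=> xM c01.
(* Induction on the list s of coefficients that may lie strictly between 0 and 1. *)
suff H (s : seq Q) : forall c : Q -> R, (forall q, 0 <= c q <= 1) ->
    (forall q, q \notin s -> (c q == 0) || (c q == 1)) ->
    rnorm (\sum_q (c q)%:C *: x q) <= M.
  by apply: (H (index_enum Q)) => // q; rewrite mem_index_enum.
elim: s => [|a s IH] {}c {}c01 cs.
  rewrite (_ : \sum_q _ = \sum_(q | c q == 1) x q) ?xM//.
  rewrite [RHS]big_mkcond; apply: eq_bigr => q _.
  case/orP: (cs q isT) => /eqP ->; first by rewrite eq_sym oner_eq0 scale0r.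
  by rewrite eqxx scale1r.
pose d (r : R) q := if q == a then r else c q.
have dM r : (r == 0) || (r == 1) -> rnorm (\sum_q (d r q)%:C *: x q) <= M.
  move=> r01; apply: IH => q; rewrite /d; case: (eqVneq q a) => [_|qa].
  - by case/orP: r01 => /eqP ->; rewrite ?ler01 ?lexx.
  - exact: c01.
  - by [].
  - by move=> qs; apply: cs; rewrite inE negb_or qa.
have -> : \sum_q (c q)%:C *: x q
    = (c a)%:C *: (\sum_q (d 1 q)%:C *: x q) + (1 - c a)%:C *: (\sum_q (d 0 q)%:C *: x q).
  rewrite !scaler_sumr -big_split/=; apply: eq_bigr => q _.
  rewrite !scalerA -scalerDl -!rmorphM -rmorphD/=; congr (_%:C *: _).
  by rewrite /d; case: eqVneq => [->|_]; ring.
have /andP[ca0 ca1] := c01 a.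
rewrite (le_trans (rnormD _ _))// !rnormZ !rnorm_real ger0_norm// ger0_norm ?subr_ge0//.
rewrite (_ : M = c a * M + (1 - c a) * M); last by ring.
by rewrite lerD// ler_wpM2l ?subr_ge0// dM// eqxx ?orbT.
Qed.

(** A real coefficient of modulus at most eta is eta (2 d - 1) with d in [0, 1],
    which costs a factor 3; the real and imaginary parts double it. *)
Lemma rnorm_scaled_sum_le x M (c : Q -> R[i]) (eta : R) :
    (forall S : pred Q, rnorm (\sum_(q | S q) x q) <= M) ->
    0 < eta -> (forall q, rnorm (c q) <= eta) ->
  rnorm (\sum_q c q *: x q) <= 6 * M * eta.
Proof.
move=> xM eta0 ceta.
have realM (b : Q -> R) : (forall q, `|b q| <= eta) ->
    rnorm (\sum_q (b q)%:C *: x q) <= 3 * M * eta.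
  move=> beta.
  have -> : \sum_q (b q)%:C *: x q
      = (2 * eta)%:C *: (\sum_q ((b q / eta + 1) / 2)%:C *: x q) - eta%:C *: \sum_q x q.
    rewrite !scaler_sumr -sumrB; apply: eq_bigr => q _.
    rewrite scalerA -scalerBl -rmorphM -rmorphB/=; congr (_%:C *: _).
    by field; rewrite gt_eqF.
  rewrite (le_trans (rnormB _ _))// !rnormZ !rnorm_real !gtr0_norm ?mulr_gt0//.
  rewrite (_ : 3 * M * eta = 2 * eta * M + eta * M); last by ring.
  rewrite lerD// ler_wpM2l ?mulr_ge0 ?(ltW eta0)// ?rnorm_convex_sum_le//.
  move=> q; have : `|b q / eta| <= 1.
    by rewrite normrM normfV (gtr0_norm eta0) ler_pdivrMr// mul1r.
  by rewrite ler_norml => /andP[? ?]; apply/andP; split; lra.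
have -> : \sum_q c q *: x q = \sum_q (complex.Re (c q))%:C *: x q
   + 'i%C *: \sum_q (complex.Im (c q))%:C *: x q.
  rewrite scaler_sumr -big_split/=; apply: eq_bigr => q _.
  by rewrite scalerA -scalerDl -complexE.
rewrite (le_trans (rnormD _ _))// rnormZ.
rewrite (_ : 6 * M * eta = 3 * M * eta + 1 * (3 * M * eta)); last by ring.
have -> : rnorm ('i%C : R[i]) = 1.
  by rewrite /rnorm normc_def/= expr0n expr1n add0r sqrtr1.
rewrite !mul1r lerD ?realM// => q.
  exact: le_trans (rnorm_ge_Re _) (ceta q).
exact: le_trans (rnorm_ge_Im _) (ceta q).
Qed.

End subset_sums.

Section vintegral_theory.
Context {R : realType} {X : completeNormedModType R[i]}.
Variables (mu : set (measurableTypeR R) -> X) (M : R).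
Hypotheses (muV : vector_measure mu) (muM : (measure_variation mu <= M%:E)%E).
Implicit Types s : measurableTypeR R -> R[i].

Lemma simple_vintegralE (Q : finType) (p : measurableTypeR R -> Q) (phi : Q -> R[i]) :
    (forall q, measurable (p @^-1` [set q])) ->
  simple_vintegral mu (phi \o p) = \sum_q phi q *: mu (p @^-1` [set q]).
Proof.
move=> mp; rewrite /simple_vintegral.
apply: (sum_over_values (B := fun c A => c *: mu A)) => v.
  by rewrite vector_measure0// scaler0.
by rewrite -scaler_sumr -finitely_additive_fibers//; exact: vector_measure_additive.
Qed.

(** The values of mu on unions of cells are bounded by the variation, so the
    integral of a simple function is Lipschitz for the uniform norm. *)
Lemma simple_vintegral_lipschitz s s' (eta : R) : simple_fun s -> simple_fun s' ->
    0 < eta -> (forall t, rnorm (s t - s' t) <= eta) ->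
  rnorm (simple_vintegral mu s - simple_vintegral mu s') <= 6 * M * eta.
Proof.
move=> /simple_fun_fibers[n [p [phi [-> mp]]]] /simple_fun_fibers[n' [p' [phi' [-> mp']]]].
move=> eta0 seta.
pose P t := (p t, p' t); have mP := measurable_pair_fiber mp mp'.
rewrite (_ : phi \o p = (phi \o fst) \o P)// (_ : phi' \o p' = (phi' \o snd) \o P)//.
rewrite !simple_vintegralE// -sumrB.
under eq_bigr do rewrite -scalerBl.
(* On an empty cell the two values are unrelated, but the measure is 0: the
   coefficient may be replaced by 0 there. *)
pose c q := if `[< exists t, P t = q >] then phi q.1 - phi' q.2 else 0.
rewrite (eq_bigr (fun q => c q *: mu (P @^-1` [set q]))); last first.
  move=> q _ /=; rewrite /c; case: asboolP => // h.
  rewrite (_ : P @^-1` [set q] = set0) ?vector_measure0 ?scaler0//.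
  by apply/seteqP; split => // t tq; case: h; exists t.
apply: rnorm_scaled_sum_le => // [S|q].
  rewrite -(finitely_additive_fibers _ (vector_measure_additive muV) mP).
  apply: (rnorm_vector_measure_le muV muM).
  have [_ /(_ true)] := @simple_fun_comp _ _ _ _ P S mP.
  congr measurable; apply/seteqP; split => t //=.
rewrite /c; case: asboolP => [[t <-]|_]; first exact: (seta t).
by rewrite (@rnorm0 R R[i]^o) ltW.
Qed.

(** The integral is the limit along any uniformly convergent sequence of simple
    functions: the Lipschitz bound makes such integrals Cauchy, and forces the
    sequence behind the chosen value to have the same limit. *)
Lemma vintegral_lim (f : measurableTypeR R -> R[i]) (s : nat -> measurableTypeR R -> R[i]) :
    (forall n, simple_fun (s n)) ->
    (forall e : R, 0 < e -> \forall n \near \oo, forall t, rnorm (s n t - f t) < e) ->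
  simple_vintegral mu (s n) @[n --> \oo] --> vintegral mu f.
Proof.
move=> ss sf.
have M0 : 0 <= M.
  by have := rnorm_vector_measure_le muV muM measurable0; apply: le_trans; exact: rnorm_ge0.
have close (s1 s2 : nat -> measurableTypeR R -> R[i]) :
    (forall n, simple_fun (s1 n)) -> (forall n, simple_fun (s2 n)) ->
    (forall e : R, 0 < e -> \forall n \near \oo, forall t, rnorm (s1 n t - f t) < e) ->
    (forall e : R, 0 < e -> \forall n \near \oo, forall t, rnorm (s2 n t - f t) < e) ->
    forall e : R, 0 < e -> exists N, forall m n, (N <= m)%N -> (N <= n)%N ->
      rnorm (simple_vintegral mu (s1 m) - simple_vintegral mu (s2 n)) < e.
  move=> ss1 ss2 sf1 sf2 e e0.
  pose eta := e / (2 * (6 * M + 1)).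
  have eta0 : 0 < eta by rewrite divr_gt0// mulr_gt0// ltr_wpDl// mulr_ge0.
  have [N1 _ H1] := sf1 _ eta0; have [N2 _ H2] := sf2 _ eta0.
  exists (maxn N1 N2) => m n; rewrite !geq_max => /andP[N1m _] /andP[_ N2n].
  apply: (@le_lt_trans _ _ (6 * M * (2 * eta))).
    apply: simple_vintegral_lipschitz => //; first by rewrite mulr_gt0.
    move=> t; rewrite -[s1 m t](subrK (f t)) -addrA.
    rewrite (le_trans (@rnormD R R[i]^o _ _))// mulr_natl mulr2n lerD//.
      exact/ltW/H1.
    by rewrite (@rnormBC R R[i]^o); exact/ltW/H2.
  have -> : e = (6 * M + 1) * (2 * eta).
    by rewrite /eta; field; rewrite gt_eqF// ltr_wpDl// mulr_ge0.
  clearbody eta; rewrite -subr_gt0 (_ : _ - _ = 2 * eta) ?mulr_gt0//; ring.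
have cs : cvg (simple_vintegral mu (s n) @[n --> \oo]).
  apply/cauchy_cvgP/cauchy_ballP => e e0.
  have er : e = (complex.Re e)%:C by rewrite RRe_real// realE ltW.
  rewrite er ltcR in e0; have [N HN] := close s s ss ss sf sf _ e0.
  pose tail := [set v | exists2 m, (N <= m)%N & v = simple_vintegral mu (s m)].
  exists (tail, tail) => /=; first by split; exists N => // m Nm; exists m.
  move=> [_ _] [/= [m Nm ->] [n Nn ->]].
  by rewrite -ball_normE /= er rnormE ltcR; exact: HN.
rewrite /vintegral.
have : [set v | is_vintegral mu f v] (get [set v | is_vintegral mu f v]).
  by apply: (@getI _ _ (lim (simple_vintegral mu (s n) @[n --> \oo]))); exists s; split.
move=> /= [s' [ss' sf' /cvg_rnormP cs']]; apply/cvg_rnormP => e e0.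
have e20 : 0 < e / 2 by rewrite divr_gt0.
have [N HN] := close s' s ss' ss sf' sf _ e20; have [N' _ HN'] := cs' _ e20.
exists N => // n /= Nn.
rewrite -[X in X - _](subrK (simple_vintegral mu (s' (maxn N N')))) -addrA.
rewrite (le_lt_trans (rnormD _ _))// [e]splitr ltrD//.
  by apply: HN' => /=; rewrite leq_maxr.
by apply: HN => //; rewrite leq_maxl.
Qed.

End vintegral_theory.

Section grid.
Context {R : realType}.
Implicit Types (n k : nat) (u : R).

(** The cells of mesh 1/(n+1) that tile [-(n+1), n+1[; both the mesh and the
    range improve with n, as needed to approximate the Cauchy kernel uniformly
    on the whole line. *)
Definition grid_size n := (2 * n.+1 * n.+1)%N.

Definition grid_point n k : R := k%:R / n.+1%:R - n.+1%:R.

Definition grid_cell n k : set R :=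
  [set u | grid_point n k <= u < grid_point n k + n.+1%:R^-1].

Lemma grid_cellE n k u : grid_cell n k u <->
  k%:R <= (u + n.+1%:R) * n.+1%:R < k.+1%:R.
Proof.
have n0 : 0 < n.+1%:R :> R by rewrite ltr0n.
rewrite /grid_cell /grid_point /=.
rewrite addrAC (_ : _ + n.+1%:R^-1 = k.+1%:R / n.+1%:R); last first.
  by rewrite -natr1; field; rewrite gt_eqF.
by rewrite lerBlDr ltrBrDr ler_pdivrMr// ltr_pdivlMr.
Qed.

Lemma grid_cell_inj n k k' u : grid_cell n k u -> grid_cell n k' u -> k = k'.
Proof. by move=> /grid_cellE/truncn_def <- /grid_cellE/truncn_def <-. Qed.

Lemma grid_cell_cover n u : `|u| < n.+1%:R ->
  exists k : 'I_(grid_size n), grid_cell n k u.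
Proof.
move=> un; have n0 : 0 < n.+1%:R :> R by rewrite ltr0n.
move: un; rewrite ltr_norml => /andP[un un'].
pose v := (u + n.+1%:R) * n.+1%:R.
have v0 : 0 <= v by rewrite mulr_ge0// -lerBlDr sub0r ltW.
have vn : (Num.truncn v < grid_size n)%N.
  rewrite truncn_lt_nat// /grid_size !natrM ltr_pM2r//.
  by rewrite mulr_natl mulr2n ltrD2r.
by exists (Ordinal vn); apply/grid_cellE; exact: truncn_itv.
Qed.

Lemma grid_cell_itv n k :
  grid_cell n k = `[grid_point n k, grid_point n k + n.+1%:R^-1[%classic.
Proof. by apply/seteqP; split => u; rewrite /= in_itv. Qed.

(** Points off the range of the grid get the value None, so that the fibers of
    this map form a finite measurable partition of the line. *)
Definition grid_index n u : option 'I_(grid_size n) :=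
  [pick k : 'I_(grid_size n) | `[< grid_cell n k u >]].

Lemma grid_index_some n (k : 'I_(grid_size n)) : grid_index n @^-1` [set Some k] = grid_cell n k.
Proof.
rewrite /grid_index; apply/seteqP; split => u /=.
  by case: pickP => // k' /asboolP + [<-].
move=> ku; case: pickP => [k' /asboolP k'u|/(_ k)/asboolP//].
by congr Some; apply/val_inj; exact: grid_cell_inj k'u ku.
Qed.

Lemma measurable_grid_index n q :
  measurable ((grid_index n : measurableTypeR R -> _) @^-1` [set q]).
Proof.
have mS (k : 'I_(grid_size n)) : measurable ((grid_index n : measurableTypeR R -> _) @^-1` [set Some k]).
  by rewrite grid_index_some grid_cell_itv; exact: measurable_itv.
case: q => [k|]; first exact: mS.
rewrite (_ : _ @^-1` _ = ~` \big[setU/set0]_k grid_index n @^-1` [set Some k]).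
  by apply: measurableC; apply: bigsetU_measurable.
rewrite -bigcup_seq; apply/seteqP; split => u /=.
  by move=> un [k /= _]; rewrite un.
case E : (grid_index n u) => [k|//]; case.
by exists k => //=; rewrite mem_index_enum.
Qed.

End grid.

Section cauchy_kernel.
Context {R : realType}.
Implicit Types t u x y : R.

Lemma rnorm_kernel_ge_Im t x y : 0 < y -> y <= rnorm (t%:C - (x +i* y)).
Proof.
move=> y0; apply: le_trans (rnorm_ge_Im _) => /=.
by rewrite sub0r normrN gtr0_norm.
Qed.

Lemma rnorm_kernel_ge_Re t x y : `|t - x| <= rnorm (t%:C - (x +i* y)).
Proof. exact: le_trans (rnorm_ge_Re _). Qed.

Lemma kernel_neq0 t x y : 0 < y -> t%:C - (x +i* y) != 0.
Proof.
move=> y0; apply/eqP => h; have := rnorm_kernel_ge_Im t x y0.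
by rewrite h (@rnorm0 R R[i]^o) leNgt y0.
Qed.

Lemma rnorm_kernelB t u x y : 0 < y ->
  rnorm ((t%:C - (x +i* y))^-1 - (u%:C - (x +i* y))^-1) <= `|t - u| / (y * y).
Proof.
move=> y0; have t0 := kernel_neq0 t x y0; have u0 := kernel_neq0 u x y0.
have -> : (t%:C - (x +i* y))^-1 - (u%:C - (x +i* y))^-1
    = (u - t)%:C * ((t%:C - (x +i* y))^-1 * (u%:C - (x +i* y))^-1).
  rewrite rmorphB/=; field; apply/andP; split => //.
rewrite !rnormCM !rnormV rnorm_real distrC ler_wpM2l// invfM.
have kV v : (rnorm (v%:C - (x +i* y)))^-1 <= y^-1.
  rewrite lef_pV2 ?posrE ?rnorm_kernel_ge_Im//.
  by rewrite (lt_le_trans y0)// rnorm_kernel_ge_Im.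
by rewrite ler_pM// invr_ge0; exact: (@rnorm_ge0 R R[i]^o).
Qed.

End cauchy_kernel.

Section cauchy_transform_discretization.
Context {R : realType} {X : completeNormedModType R[i]}.
Variables (mu : set (measurableTypeR R) -> X) (M : R).
Hypotheses (muV : vector_measure mu) (muM : (measure_variation mu <= M%:E)%E).

(** The Cauchy transform is a pointwise limit of the transforms of point masses
    mu (grid_cell n k) at the grid points: on the range of the grid the kernel is
    Lipschitz with constant 1/y^2, and off it the kernel is small. *)
Lemma cauchy_transform_grid (x y : R) : 0 < y ->
  \sum_(k < grid_size n) ((grid_point n k)%:C - (x +i* y))^-1 *: mu (grid_cell n k)
    @[n --> \oo] --> cauchy_transform mu (x +i* y).
Proof.
move=> y0; pose f (t : measurableTypeR R) := (t%:C - (x +i* y))^-1.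
pose phi n (q : option 'I_(grid_size n)) : R[i] :=
  oapp (fun k : 'I__ => f (grid_point n k)) 0 q.
pose s n : measurableTypeR R -> R[i] := phi n \o (grid_index n : measurableTypeR R -> _).
have E n : simple_vintegral mu (s n)
    = \sum_(k < grid_size n) ((grid_point n k)%:C - (x +i* y))^-1 *: mu (grid_cell n k).
  rewrite simple_vintegralE//; last exact: measurable_grid_index.
  rewrite (bigD1 None)//= scale0r add0r (reindex_omap Some id)/=; last by case.
  by apply: eq_big => [k|k _]; rewrite ?eqxx// grid_index_some.
under eq_fun do rewrite -E.
apply: (vintegral_lim muV muM) => [n|e e0].
  by apply: simple_fun_comp; exact: measurable_grid_index.
have : (n.+1%:R^-1 / (y * y) : R) @[n --> \oo] --> 0 / (y * y).
  by apply: cvgM; [exact: cvg_harmonic|exact: cvg_cst].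
rewrite mul0r => /cvgrPdist_lt/(_ _ e0) He.
have Hx : \forall n \near \oo, `|x| + e^-1 < n%:R :> R by exact: nbhs_infty_gtr.
near=> n => t; rewrite /s /=.
case E1 : (grid_index n t) => [k|] /=.
  have : grid_cell n k t by rewrite -grid_index_some.
  move=> /andP[t1 t2]; rewrite (le_lt_trans (rnorm_kernelB _ _ _ y0))//.
  apply: (@le_lt_trans _ _ (n.+1%:R^-1 / (y * y))).
    rewrite ler_wpM2r// ?invr_ge0 ?mulr_ge0 ?(ltW y0)// distrC ger0_norm ?subr_ge0//.
    by rewrite lerBlDl ltW.
  have : `|0 - n.+1%:R^-1 / (y * y)| < e by near: n.
  by rewrite sub0r normrN ger0_norm// divr_ge0// mulr_ge0// ltW.
have tn : n.+1%:R <= `|t|.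
  by rewrite leNgt; apply/negP => /grid_cell_cover[k]; rewrite -grid_index_some /= E1.
rewrite sub0r (@rnormN R R[i]^o) rnormV.
have et : e^-1 < `|t - x|.
  apply: (lt_le_trans _ (lerB_dist _ _)); rewrite ltrBrDl.
  apply: (lt_le_trans _ tn); apply: (@lt_trans _ _ n%:R); first by near: n.
  by rewrite ltr_nat.
have et' : e^-1 < rnorm (t%:C - (x +i* y)).
  exact: lt_le_trans et (rnorm_kernel_ge_Re _ _ _).
by rewrite -[e]invrK ltf_pV2// posrE ?invr_gt0// (lt_trans _ et') ?invr_gt0.
Unshelve. all: by end_near. Qed.

Lemma grid_variation_le n :
  ((\sum_(k < grid_size n) rnorm (mu (grid_cell n k)))%:E <= measure_variation mu)%E.
Proof.
apply: ereal_sup_ubound; exists (grid_size n), (fun k => grid_cell n k); split => //.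
  by move=> k; rewrite grid_cell_itv; exact: interval_is_interval.
by move=> i j _ _ [u [iu ju]]; apply/val_inj; exact: grid_cell_inj iu ju.
Qed.

End cauchy_transform_discretization.

(** * Bochner integrals of finite combinations *)

Section bochner_theory.
Import HBSimple.
Context {R : realType} {X : completeNormedModType R[i]}.
Context d (T : measurableType d) (m : {measure set T -> \bar R}).
Implicit Types s : T -> X.

Lemma measurable_fibers_comp (Q : finType) (p : T -> Q) (g : Q -> R) :
  (forall q, measurable (p @^-1` [set q])) -> measurable_fun setT (g \o p).
Proof.
move=> mp _ Y mY; rewrite setTI.
rewrite (_ : _ @^-1` _ = \big[setU/set0]_(q | g q \in Y) p @^-1` [set q]).
  by apply: bigsetU_measurable.
rewrite -bigcup_seq_cond; apply/seteqP; split => t /=.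
  by move=> tY; exists (p t) => //=; rewrite mem_index_enum inE.
by move=> [q /= /andP[_]]; rewrite inE => + ->.
Qed.

Lemma fibers_indic_sum (Q : finType) (p : T -> Q) (g : Q -> R) t :
  g (p t) = \sum_q g q * \1_(p @^-1` [set q]) t.
Proof.
rewrite (bigD1 (p t))//= indicE mem_set// mulr1 big1 ?addr0// => q qp.
rewrite indicE memNset ?mulr0// => /= h; by rewrite h eqxx in qp.
Qed.

Lemma ge0_integral_fibers (Q : finType) (p : T -> Q) (g : Q -> R) :
    (forall q, measurable (p @^-1` [set q])) -> (forall q, 0 <= g q) ->
  (\int[m]_t (g (p t))%:E = \sum_q (g q)%:E * m (p @^-1` [set q]))%E.
Proof.
move=> mp g0; under eq_integral do rewrite fibers_indic_sum -sumEFin.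
rewrite ge0_integral_sum//.
- apply: eq_bigr => q _; under eq_integral do rewrite EFinM.
  rewrite ge0_integralZl//= ?lee_fin//; first by rewrite integral_indic// setIT.
  exact/measurable_EFinP.
- move=> q; apply/measurable_EFinP; apply: measurable_funM => //.
- by move=> q t _; rewrite lee_fin mulr_ge0.
Qed.

Lemma integral_fibers (Q : finType) (p : T -> Q) (g : Q -> R) :
    (forall q, measurable (p @^-1` [set q])) ->
    (forall q, g q != 0 -> (m (p @^-1` [set q]) < +oo)%E) ->
  (\int[m]_t (g (p t))%:E = \sum_q (g q)%:E * m (p @^-1` [set q]))%E.
Proof.
move=> mp gfin; pose h q t : \bar R := (g q * \1_(p @^-1` [set q]) t)%:E.
have inth q : m.-integrable setT (h q).
  have [g0|g0] := eqVneq (g q) 0.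
    rewrite (_ : h q = cst 0%E); first exact: integrable0.
    by apply/funext => t; rewrite /h g0 mul0r.
  rewrite (_ : h q = (fun t => (g q)%:E * (\1_(p @^-1` [set q]) t)%:E)%E).
    apply: integrableZl => //; apply/integrableP; split.
      exact/measurable_EFinP.
    under eq_integral do rewrite gee0_abs ?lee_fin//.
    by rewrite integral_indic// setIT gfin.
  by apply/funext => t; rewrite /h EFinM.
under eq_integral do rewrite fibers_indic_sum -sumEFin.
rewrite (@integral_sum _ _ _ m _ _ _ h)//; apply: eq_bigr => q _.
have [g0|g0] := eqVneq (g q) 0.
  by rewrite g0 mul0e integral0_eq// => t _; rewrite /h g0 mul0r.
rewrite /h; under eq_integral do rewrite EFinM.
rewrite integralZl ?integral_indic ?setIT//.
apply/integrableP; split; first exact/measurable_EFinP.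
under eq_integral do rewrite gee0_abs ?lee_fin//.
by rewrite integral_indic// setIT gfin.
Qed.

Lemma simple_integralE (Q : finType) (p : T -> Q) (phi : Q -> X) :
    (forall q, measurable (p @^-1` [set q])) ->
    (forall q, phi q != 0 -> (m (p @^-1` [set q]) < +oo)%E) ->
  simple_integral m (phi \o p) = \sum_q (fine (m (p @^-1` [set q])))%:C *: phi q.
Proof.
move=> mp fin; rewrite /simple_integral.
apply: (sum_over_values (B := fun v A => (fine (m A))%:C *: v)) => v.
  by rewrite measure0 scale0r.
have [->|v0] := eqVneq v 0.
  by rewrite scaler0 big1// => q _; rewrite scaler0.
rewrite -scaler_suml -(raddf_sum (real_complex R))/= sum_fine; last first.
  by move=> q /eqP qv; rewrite ge0_fin_numE// fin// qv.
congr ((fine _)%:C *: _); apply: finitely_additive_fibers => //; split=> // A B mA mB AB.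
by rewrite measureU.
Qed.

Lemma integrable_simple_fun_fibers s : integrable_simple_fun m s ->
  exists (n : nat) (p : T -> 'I_n.+1) (phi : 'I_n.+1 -> X),
    [/\ s = phi \o p, forall q, measurable (p @^-1` [set q]) &
      forall q, phi q != 0 -> (m (p @^-1` [set q]) < +oo)%E].
Proof.
move=> [ss fs]; have [n [p [phi [sE mp]]]] := simple_fun_fibers ss.
exists n, p, phi; split => // q q0; apply: le_lt_trans (fs _ q0).
rewrite le_measure ?inE//; first by have [_] := ss; apply.
by move=> t /= <-; rewrite sE.
Qed.

Lemma integrable_simple_fun_comp (Q : finType) (p : T -> Q) (phi : Q -> X) :
    (forall q, measurable (p @^-1` [set q])) ->
    (forall q, phi q != 0 -> (m (p @^-1` [set q]) < +oo)%E) ->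
  integrable_simple_fun m (phi \o p).
Proof.
move=> mp fin; split; first exact: simple_fun_comp.
move=> v v0; rewrite (_ : _ @^-1` _ = p @^-1` [set q | phi q == v]); last first.
  by apply/seteqP; split => t /=; [move=> ->|move=> /eqP].
rewrite (finitely_additive_fibers (nu := m))//; last first.
  by split=> // A B mA mB AB; rewrite measureU.
by apply: lte_sum_pinfty => q /eqP qv; apply: fin; rewrite qv.
Qed.

(** Two integrable simple functions are constant on the cells of a common
    finite partition, which reduces the linear theory to finite sums. *)
Lemma common_fibers s s' : integrable_simple_fun m s -> integrable_simple_fun m s' ->
  exists (Q : finType) (p : T -> Q) (phi phi' : Q -> X),
    [/\ s = phi \o p, s' = phi' \o p, forall q, measurable (p @^-1` [set q]),
      forall q, phi q != 0 -> (m (p @^-1` [set q]) < +oo)%E &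
      forall q, phi' q != 0 -> (m (p @^-1` [set q]) < +oo)%E].
Proof.
move=> /integrable_simple_fun_fibers[n [p [phi [-> mp fp]]]].
move=> /integrable_simple_fun_fibers[n' [p' [phi' [-> mp' fp']]]].
have mP := measurable_pair_fiber mp mp'.
exists ('I_n.+1 * 'I_n'.+1)%type, (fun t => (p t, p' t)), (phi \o fst), (phi' \o snd).
split => // -[q q'] /= q0.
  apply: le_lt_trans (fp _ q0); rewrite le_measure ?inE//.
  by move=> t /= [-> _].
apply: le_lt_trans (fp' _ q0); rewrite le_measure ?inE//.
by move=> t /= [_ ->].
Qed.

Lemma integrable_simple_funD s s' :
  integrable_simple_fun m s -> integrable_simple_fun m s' ->
  integrable_simple_fun m (fun t => s t + s' t) /\
  simple_integral m (fun t => s t + s' t) = simple_integral m s + simple_integral m s'.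
Proof.
move=> is1 is2; have [Q [p [phi [phi' [-> -> mp f1 f2]]]]] := common_fibers is1 is2.
pose psi q := phi q + phi' q.
have f3 q : psi q != 0 -> (m (p @^-1` [set q]) < +oo)%E.
  rewrite /psi; have [->|q0 _] := eqVneq (phi q) 0; last exact: f1.
  by rewrite add0r; exact: f2.
rewrite (_ : (fun t => _) = psi \o p)//; split.
  exact: integrable_simple_fun_comp.
by rewrite !simple_integralE// -big_split; apply: eq_bigr => q _; rewrite scalerDr.
Qed.

Lemma rnorm_simple_integralB_le s s' :
  integrable_simple_fun m s -> integrable_simple_fun m s' ->
  ((rnorm (simple_integral m s - simple_integral m s'))%:E
     <= \int[m]_t (rnorm (s t - s' t))%:E)%E.
Proof.
move=> is1 is2; have [Q [p [phi [phi' [-> -> mp f1 f2]]]]] := common_fibers is1 is2.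
rewrite !simple_integralE// -sumrB.
rewrite (@ge0_integral_fibers _ p (fun q => rnorm (phi q - phi' q)))//; last first.
  by move=> q; exact: rnorm_ge0.
apply: (@le_trans _ _ (\sum_q (rnorm (phi q - phi' q) * fine (m (p @^-1` [set q])))%:E)%E).
  rewrite sumEFin lee_fin (le_trans (rnorm_sum _ _ _))// ler_sum// => q _.
  by rewrite -scalerBr rnormZ rnorm_real ger0_norm ?fine_ge0// mulrC.
apply: lee_sum => q _; rewrite EFinM lee_wpmul2l ?lee_fin ?rnorm_ge0//.
have [->|f] := eqVneq (m (p @^-1` [set q])) +oo%E; first by rewrite leey.
by rewrite fineK// ge0_fin_numE// ltey.
Qed.

Lemma measurable_rnorm_simpleB s s' : simple_fun s -> simple_fun s' ->
  measurable_fun setT (fun t => rnorm (s t - s' t)).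
Proof.
move=> /simple_fun_fibers[n [p [phi [-> mp]]]] /simple_fun_fibers[n' [p' [phi' [-> mp']]]].
exact: (measurable_fibers_comp (fun q => rnorm (phi q.1 - phi' q.2))
  (measurable_pair_fiber mp mp')).
Qed.

Lemma measurable_rnorm_simple_limB s f (s_ : nat -> T -> X) : simple_fun s ->
    (forall n, simple_fun (s_ n)) -> (forall t, s_ n t @[n --> \oo] --> f t) ->
  measurable_fun setT (fun t => rnorm (s t - f t)).
Proof.
move=> ss ss_ sf; apply: (@measurable_fun_cvg _ _ _ _ (fun n t => rnorm (s t - s_ n t))).
  by move=> n; exact: measurable_rnorm_simpleB.
by move=> t _; apply: cvg_rnorm; apply: cvgB => //; exact: cvg_cst.
Qed.

(** The Bochner integral is a chosen limit; comparing two approximating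
    sequences through the L^1 norm of their difference shows that the limit does
    not depend on the choice. *)
Lemma bochner_integral_unique f (s_ : nat -> T -> X) v :
    (forall n, integrable_simple_fun m (s_ n)) ->
    (forall t, s_ n t @[n --> \oo] --> f t) ->
    (\int[m]_t (rnorm (s_ n t - f t))%:E)%E @[n --> \oo] --> 0%E ->
    simple_integral m (s_ n) @[n --> \oo] --> v ->
  bochner_integral m f = v.
Proof.
move=> is_ sf L1 Iv; rewrite /bochner_integral.
have : [set v | is_bochner_integral m f v] (get [set v | is_bochner_integral m f v]).
  by apply: (@getI _ _ v); exists s_; split => //; apply: aeW.
move: (get _) => w /= [s' [is' _ L1' Iw]].
apply/eqP; rewrite eq_sym -subr_eq0; apply/eqP/rnorm_eq0.
have mB (s : nat -> T -> X) n : (forall n, integrable_simple_fun m (s n)) ->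
    measurable_fun setT (fun t => (rnorm (s n t - f t))%:E : \bar R).
  move=> is1; apply/measurable_EFinP; apply: (measurable_rnorm_simple_limB _ _ sf).
    by have [] := is1 n.
  by move=> k; have [] := is_ k.
have le0 : \forall n \near \oo, ((rnorm (simple_integral m (s_ n) - simple_integral m (s' n)))%:E
    <= \int[m]_t (rnorm (s_ n t - f t))%:E + \int[m]_t (rnorm (s' n t - f t))%:E)%E.
  apply: nearW => n; apply: (le_trans (rnorm_simple_integralB_le (is_ n) (is' n))).
  rewrite -ge0_integralD//=; try (by move=> t _; rewrite lee_fin rnorm_ge0); try exact: mB.
  apply: ge0_le_integral => //.
  - by move=> t _; rewrite lee_fin rnorm_ge0.
  - apply/measurable_EFinP; apply: measurable_rnorm_simpleB.
      by have [] := is_ n.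
    by have [] := is' n.
  - by apply: emeasurable_funD; exact: mB.
  move=> t _; rewrite -EFinD lee_fin.
  rewrite -[s_ n t - s' n t](_ : (s_ n t - f t) - (s' n t - f t) = _) ?rnormB//.
  by rewrite opprB addrA subrK.
have cv : (rnorm (simple_integral m (s_ n) - simple_integral m (s' n)))%:E @[n --> \oo]
    --> (rnorm (v - w))%:E.
  by apply: cvg_EFin; [exact: nearW|apply: cvg_rnorm; exact: cvgB].
have cv0 : (\int[m]_t (rnorm (s_ n t - f t))%:E + \int[m]_t (rnorm (s' n t - f t))%:E)%E
    @[n --> \oo] --> (0 + 0)%E by apply: cvgeD.
have : ((rnorm (v - w))%:E <= 0)%E.
  by move: cv0; rewrite adde0 => cv0; apply: (lee_cvg_to cv cv0 le0).
by rewrite lee_fin => h; apply/eqP; rewrite eq_le h rnorm_ge0.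
Qed.

Lemma integrable_simple_fun_scale (g : {sfun T >-> R}) (v : X) :
    m.-integrable setT (EFin \o g) ->
  integrable_simple_fun m (fun t => (g t)%:C *: v) /\
  simple_integral m (fun t => (g t)%:C *: v) = (fine (\int[m]_t (g t)%:E))%:C *: v.
Proof.
move=> ig.
have sg : simple_fun (g : T -> R).
  by split; [exact: fimfunP|move=> r; exact: measurable_sfunP].
have [n [p [phi [gE mp]]]] := simple_fun_fibers sg.
have fin q : phi q != 0 -> (m (p @^-1` [set q]) < +oo)%E.
  move=> q0; have /integrableP[_] := ig.
  rewrite gE (@ge0_integral_fibers _ p (fun q => `|phi q|))// => sumfin.
  have q1 : 0 < `|phi q| by rewrite normr_gt0.
  have : (`|phi q|%:E * m (p @^-1` [set q]) < +oo)%E.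
    apply: le_lt_trans sumfin; rewrite (bigD1 q)//= leeDl//; apply: sume_ge0 => q' _.
    by apply: mule_ge0; rewrite ?lee_fin.
  have := measure_ge0 m (p @^-1` [set q]); case: (m _) => [r _ _|_|//].
    by rewrite ltry.
  by rewrite gt0_muley// lte_fin.
pose psi q := (phi q)%:C *: v.
have finpsi q : psi q != 0 -> (m (p @^-1` [set q]) < +oo)%E.
  by move=> q0; apply: fin; apply: contra_neq q0; rewrite /psi => ->; rewrite scale0r.
rewrite (_ : (fun t => _) = psi \o p); last by rewrite gE.
split; first exact: integrable_simple_fun_comp.
rewrite simple_integralE// gE integral_fibers//.
rewrite -sum_fine; last first.
  move=> q _; have [->|q0] := eqVneq (phi q) 0; first by rewrite mul0e.
  by rewrite fin_numM// ge0_fin_numE// fin.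
rewrite raddf_sum/= scaler_suml; apply: eq_bigr => q _.
rewrite /psi scalerA; congr (_ *: _).
have [->|q0] := eqVneq (phi q) 0; first by rewrite mul0e mulr0.
have : m (p @^-1` [set q]) \is a fin_num by rewrite ge0_fin_numE// fin.
by move=> /fineK <-; rewrite -EFinM/= rmorphM/= mulrC.
Qed.

(** For a combination of finitely many vectors with integrable scalar
    coefficients, scalar simple approximations of the coefficients yield the
    approximating sequence, so the integral is computed coefficientwise. *)
Lemma bochner_integral_sum (I : Type) (r : seq I) (k : I -> T -> R) (v : I -> X) :
    (forall i, m.-integrable setT (EFin \o k i)) ->
  bochner_integral m (fun t => \sum_(i <- r) (k i t)%:C *: v i)
  = \sum_(i <- r) (fine (\int[m]_t (k i t)%:E))%:C *: v i.
Proof.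
move=> ik.
have /choice[g gP] i : exists g : {sfun T >-> R}^nat,
  [/\ (forall n, m.-integrable setT (EFin \o g n)),
      (forall t, g n t @[n --> \oo] --> k i t) &
      (\int[m]_t `|(k i t)%:E - (g n t)%:E|)%E @[n --> \oo] --> 0%E].
  have [g [ig gk g1]] := approximation_sfun_integrable measurableT (ik i).
  exists g; split => // t.
  have : (g n t)%:E @[n --> \oo] --> (k i t)%:E by exact: gk.
  by move=> /fine_cvgP[].
(* This sum dominates the L^1 distance from the approximations to the limit. *)
have c0 : (\sum_(i <- r) (rnorm (v i))%:E * \int[m]_t `|(k i t)%:E - (g i n t)%:E|)%E
    @[n --> \oo] --> 0%E.
  elim: r => [|i r IH].
    by under eq_fun do rewrite big_nil; exact: cvg_cst.
  under eq_fun do rewrite big_cons.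
  have [_ _ g1] := gP i.
  have : ((rnorm (v i))%:E * \int[m]_t `|(k i t)%:E - (g i n t)%:E|)%E @[n --> \oo]
      --> ((rnorm (v i))%:E * 0)%E by exact: cvgeZl.
  by rewrite mule0 => ci; have := cvgeD _ ci IH; rewrite adde0; apply.
pose s_ n t := \sum_(i <- r) (g i n t)%:C *: v i.
have is_ n : integrable_simple_fun m (s_ n) /\
    simple_integral m (s_ n) = \sum_(i <- r) (fine (\int[m]_t (g i n t)%:E))%:C *: v i.
  rewrite /s_ {s_ c0}; elim: r => [|i r IH].
    rewrite (_ : (fun t => _) = ((fun=> 0) : unit -> X) \o (fun=> tt)); last first.
      by apply/funext => t; rewrite big_nil.
    have mtt q : measurable ((fun=> tt : unit) @^-1` [set q] : set T).
      by rewrite preimage_cst; case: ifP.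
    split; first by apply: integrable_simple_fun_comp => // q; rewrite eqxx.
    rewrite simple_integralE//; last by move=> q; rewrite eqxx.
    by rewrite big_nil big1// => q _; rewrite scaler0.
  have [ig _ _] := gP i.
  have [i1 I1] := integrable_simple_fun_scale (v i) (ig n).
  have [i2 I2] := integrable_simple_funD i1 IH.1.
  rewrite (_ : (fun t => _) = (fun t => (g i n t)%:C *: v i
      + \sum_(i <- r) (g i n t)%:C *: v i)); last first.
    by apply/funext => t; rewrite big_cons.
  by split => //; rewrite big_cons I2 I1 IH.2.
have sk t : s_ n t @[n --> \oo] --> \sum_(i <- r) (k i t)%:C *: v i.
  by apply: cvg_combination => i; have [] := gP i.
apply: (bochner_integral_unique _ sk).
- by move=> n; exact: (is_ n).1.
- have mkg i n : measurable_fun setT (fun t => `|(k i t)%:E - (g i n t)%:E|%E).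
    apply: measurableT_comp => //; apply: emeasurable_funB => //.
      exact: (measurable_int _ (ik i)).
    exact/measurable_EFinP.
  apply: (squeeze_cvge _ (cvg_cst 0%E) c0); apply: nearW => n.
  rewrite integral_ge0/=; last by move=> t _; rewrite lee_fin rnorm_ge0.
  pose G i t := `|(k i t)%:E - (g i n t)%:E|%E.
  rewrite [leRHS](_ : _ = \sum_(i <- r) \int[m]_t ((rnorm (v i))%:E * G i t))%E; last first.
    apply: eq_bigr => i _; rewrite ge0_integralZl ?lee_fin ?rnorm_ge0//.
      exact: mkg.
    by move=> t _; exact: abse_ge0.
  rewrite -ge0_integral_sum//; last 2 first.
  - by move=> i; apply: measurable_funeM; exact: mkg.
  - by move=> i t _; rewrite mule_ge0 ?abse_ge0// lee_fin rnorm_ge0.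
  apply: ge0_le_integral => //.
  - by move=> t _; rewrite lee_fin rnorm_ge0.
  - apply/measurable_EFinP; apply: (measurable_rnorm_simple_limB _ _ sk).
      by have [[]] := is_ n.
    by move=> j; have [[]] := is_ j.
  - by apply: emeasurable_sum => i; apply: measurable_funeM; exact: mkg.
  move=> t _; rewrite /s_ -sumrB.
  rewrite /G; under [leRHS]eq_bigr do rewrite -EFinB /= -EFinM.
  rewrite sumEFin lee_fin (le_trans (rnorm_sum _ _ _))// ler_sum// => i _.
  by rewrite -scalerBl -rmorphB rnormZ rnorm_real distrC mulrC.
- under eq_fun do rewrite (is_ _).2.
  apply: cvg_combination => i; have [ig _ g1] := gP i.
  apply/cvgrPdist_lt => e e0.
  have : \forall n \near \oo, (\int[m]_t `|(k i t)%:E - (g i n t)%:E| < e%:E)%E.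
    by apply: (g1 [set u | (u < e%:E)%E]); apply: open_ereal_lt'; rewrite lte_fin.
  apply: filterS => n h; rewrite -lte_fin; apply: le_lt_trans h.
  have ki : (\int[m]_t (k i t)%:E)%E \is a fin_num by apply: integrable_fin_num => //; exact: ik.
  have gi : (\int[m]_t (g i n t)%:E)%E \is a fin_num by apply: integrable_fin_num => //; exact: ig.
  rewrite -[(`|_|)%:E]/(`|(_ - _)%:E|%E) EFinB (fineK ki) (fineK gi).
  rewrite -integralB//; [|exact: ik|exact: ig].
  apply: le_abse_integral => //.
  by apply: emeasurable_funB; [exact: (measurable_int _ (ik i))|exact: (measurable_int _ (ig n))].
Qed.

End bochner_theory.

(** * Hilbert transforms of step functions *)

Section logarithmic_kernel.
Context {R : realType}.
Notation leb := (@lebesgue_measure R).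
Implicit Types a b c e x y r : R.

(** The principal value of the integral of 1/(y - x) over [a, b[. *)
Definition step_log a b x : R := ln `|b - x| - ln `|a - x|.

Lemma is_derive_ln_dist x y : y != x ->
  is_derive y 1 (fun u => ln `|u - x|) (y - x)^-1.
Proof.
rewrite neq_lt => /orP[yx|xy].
- apply: (@near_eq_is_derive _ _ _ (fun u => ln (x - u))).
    near=> u; rewrite ltr0_norm ?opprB// subr_lt0.
    by near: u; exact: lt_nbhsl.
  have p : 0 < x - y by rewrite subr_gt0.
  have -> : (y - x)^-1 = (x - y)^-1 * (-1) by rewrite -opprB invrN mulrN1.
  have d : is_derive y 1 (fun u => x - u) (-1).
    by rewrite -[X in is_derive _ _ _ X]sub0r; apply: is_deriveB.
  exact: (@is_derive1_comp R (@ln R) (fun u => x - u) _ _ _ (is_derive1_ln p) d).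
- apply: (@near_eq_is_derive _ _ _ (fun u => ln (u - x))).
    near=> u; rewrite gtr0_norm// subr_gt0.
    by near: u; exact: lt_nbhsr.
  have p : 0 < y - x by rewrite subr_gt0.
  have -> : (y - x)^-1 = (y - x)^-1 * 1 by rewrite mulr1.
  have d : is_derive y 1 (fun u => u - x) 1.
    by rewrite -[X in is_derive _ _ _ X]subr0; apply: is_deriveB.
  exact: (@is_derive1_comp R (@ln R) (fun u => u - x) _ _ _ (is_derive1_ln p) d).
Unshelve. all: by end_near. Qed.

Lemma continuous_inv_dist x y : y != x -> {for y, continuous (fun u => (u - x)^-1)}.
Proof.
move=> yx; apply: (@cvgV _ _ _ _ (fun u => u - x)); first by rewrite subr_eq0.
by apply: cvgB; [exact: cvg_id|exact: cvg_cst].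
Qed.

Lemma continuous_ln_dist x y : y != x -> {for y, continuous (fun u => ln `|u - x|)}.
Proof.
move=> yx; have [d _] := is_derive_ln_dist yx.
by apply: differentiable_continuous; exact/derivable1_diffP.
Qed.

(** Away from the interval the logarithm of the distance is an antiderivative
    of the kernel, on either side. *)
Lemma step_log_mean_value a b x : a < b -> (x < a) || (b < x) ->
  exists2 xi, a < xi < b & step_log a b x = (b - a) / (xi - x).
Proof.
move=> ab xab; have ne u : a <= u <= b -> u != x.
  move=> /andP[au ub]; apply: contraTneq xab => ux.
  by rewrite -ux negb_or -!leNgt au ub.
have cont : {within `[a, b], continuous (fun u => ln `|u - x|)}.
  apply: derivable_within_continuous => u; rewrite in_itv/= => uab.
  by have [d _] := is_derive_ln_dist (ne _ uab).
have [u|xi] := @MVT R (fun u => ln `|u - x|) (fun u => (u - x)^-1) a b ab _ cont.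
  rewrite in_itv/= => /andP[au ub].
  by apply: is_derive_ln_dist; apply: ne; rewrite !ltW.
by rewrite in_itv/= => xab' E; exists xi => //; rewrite /step_log E mulrC.
Qed.

(** The left end may be open or closed, since excising the window around x
    leaves a half-open interval on one side and an open one on the other. *)
Lemma integral_inv_dist (b0 : bool) c e x : c <= e -> (x < c) || (e < x) ->
  leb.-integrable [set` Interval (BSide b0 c) (BLeft e)] (fun y => ((y - x)^-1)%:E) /\
  (\int[leb]_(y in [set` Interval (BSide b0 c) (BLeft e)]) ((y - x)^-1)%:E
     = (step_log c e x)%:E)%E.
Proof.
move=> ce xce; have ne u : c <= u <= e -> u != x.
  move=> /andP[au ub]; apply: contraTneq xce => ux.
  by rewrite -ux negb_or -!leNgt au ub.
have cinv : {within `[c, e], continuous (fun u => (u - x)^-1)}.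
  apply: continuous_in_subspaceT => u; rewrite inE/= in_itv/= => uce.
  exact: continuous_inv_dist (ne _ uce).
have sub : [set` Interval (BSide b0 c) (BLeft e)] `<=` `[c, e].
  move=> u; case: b0; rewrite /= !in_itv/= => /andP[cu ue]; rewrite (ltW ue) ?cu//.
  by rewrite (ltW cu).
have intD : leb.-integrable `[c, e] (fun y => ((y - x)^-1)%:E).
  by apply: continuous_compact_integrable => //; exact: segment_compact.
have intD' : leb.-integrable [set` Interval (BSide b0 c) (BLeft e)] (fun y => ((y - x)^-1)%:E).
  by apply: integrableS intD.
split => //.
move: ce; rewrite le_eqVlt => /predU1P[ce|ce].
  rewrite set_itv_ge ?integral_set0 /step_log ?ce ?subrr//.
  by case: (b0); rewrite bnd_simp -?leNgt.
rewrite integral_itv_bndo_bndc//; last exact: (measurable_int _ intD').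
transitivity (\int[leb]_(y in `[c, e]) ((y - x)^-1)%:E)%E.
  case: b0 {sub intD'} => //; rewrite integral_itv_obnd_cbnd//.
  apply: (measurable_int leb); apply: integrableS intD => //.
  by move=> u; rewrite /= !in_itv/= => /andP[? ->]; rewrite ltW.
rewrite (@continuous_FTC2 _ _ (fun u => ln `|u - x|))//.
  split.
  - move=> u; rewrite in_itv/= => /andP[cu ue].
    have uce : c <= u <= e by rewrite !ltW.
    by have [d _] := is_derive_ln_dist (ne _ uce).
  - apply: cvg_at_right_filter; apply: continuous_ln_dist; apply: ne.
    by rewrite lexx ltW.
  - apply: cvg_at_left_filter; apply: continuous_ln_dist; apply: ne.
    by rewrite lexx ltW.
move=> u; rewrite in_itv/= => /andP[cu ue].
have uce : c <= u <= e by rewrite !ltW.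
by rewrite derive1E; have [_ ->] := is_derive_ln_dist (ne _ uce).
Qed.

Definition truncated_kernel a b x r y : R :=
  if (a <= y < b) && (r < `|x - y|) then (y - x)^-1 else 0.

(** Once r is below the distance from x to the endpoints, the excised window
    around x cuts out equal and opposite logarithms. *)
Lemma integral_truncated_kernel a b x r : a <= b -> 0 < r ->
    r < `|a - x| -> r < `|b - x| ->
  leb.-integrable setT (fun y => (truncated_kernel a b x r y)%:E) /\
  (\int[leb]_y (truncated_kernel a b x r y)%:E = (step_log a b x)%:E)%E.
Proof.
move=> ab r0 ra rb.
have H (b0 : bool) c e : c <= e -> (x < c) || (e < x) ->
    let f y := (if y \in Interval (BSide b0 c) (BLeft e) then (y - x)^-1 else 0)%:E in
    leb.-integrable setT f /\ (\int[leb]_y f y = (step_log c e x)%:E)%E.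
  move=> ce xce f; have [iD ID] := integral_inv_dist b0 ce xce.
  have E : f = (fun y => ((y - x)^-1)%:E) \_ [set` Interval (BSide b0 c) (BLeft e)].
    by apply/funext => y; rewrite /f patchE mem_setE; case: ifP.
  rewrite E; split.
    have mD : @measurable _ (measurableTypeR R) [set` Interval (BSide b0 c) (BLeft e)] by exact: measurable_itv.
    exact: (proj1 (integrable_mkcond _ mD) iD).
  by rewrite -integral_mkcond.
have [xa|ax] := ltP x a.
  have [|i I] := H true _ _ ab; first by rewrite xa.
  rewrite (_ : (fun y => _) = (fun y => (if y \in `[a, b[ then (y - x)^-1 else 0)%:E))//.
  apply/funext => y; rewrite /truncated_kernel in_itv/=.
  case: (boolP (a <= y < b)) => //= /andP[ay yb].
  rewrite ifT//; move: ra; rewrite gtr0_norm ?subr_gt0// => ra.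
  by rewrite ltr0_norm ?subr_lt0 ?(lt_le_trans xa)// opprB (lt_le_trans ra)// lerD2r.
have [bx|xb] := ltP b x.
  have [|i I] := H true _ _ ab; first by rewrite bx orbT.
  rewrite (_ : (fun y => _) = (fun y => (if y \in `[a, b[ then (y - x)^-1 else 0)%:E))//.
  apply/funext => y; rewrite /truncated_kernel in_itv/=.
  case: (boolP (a <= y < b)) => //= /andP[ay yb].
  rewrite ifT//; move: rb; rewrite ltr0_norm ?subr_lt0// opprB => rb.
  by rewrite gtr0_norm ?subr_gt0 ?(lt_trans yb)// (lt_trans rb)// ltrD2l ltrN2.
move: ra rb; rewrite ler0_norm ?subr_le0// opprB ger0_norm ?subr_ge0// => ra rb.
have h1 : a <= x - r by rewrite lerBrDr -lerBrDl ltW.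
have h2 : x + r <= b by rewrite -lerBrDl ltW.
have [|i1 I1] := H true _ _ h1; first by rewrite ltrBlDr ltrDl r0 orbT.
have [|i2 I2] := H false _ _ h2; first by rewrite ltrDl r0.
set f1 := fun y => _ in i1 I1; set f2 := fun y => _ in i2 I2.
rewrite (_ : (fun y => _) = (f1 \+ f2)%E); last first.
  apply/funext => y; rewrite /f1 /f2 /= -EFinD; congr EFin.
  rewrite /truncated_kernel !in_itv/=.
  have [yx|xy] := leP y x.
    rewrite ger0_norm ?subr_ge0//.
    have -> : (x + r < y < b) = false by apply/negP => /andP[? _]; lra.
    rewrite addr0; congr (if _ then _ else _); apply/idP/idP.
      by move=> /andP[/andP[? ?] ?]; apply/andP; split; lra.
    by move=> /andP[? ?]; rewrite andbC; apply/and3P; split; lra.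
  rewrite ltr0_norm ?subr_lt0// opprB.
  have -> : (a <= y < x - r) = false by apply/negP => /andP[_ ?]; lra.
  rewrite add0r; congr (if _ then _ else _); apply/idP/idP.
    by move=> /andP[/andP[? ?] ?]; apply/andP; split; lra.
  by move=> /andP[? ?]; rewrite andbC; apply/and3P; split; lra.
rewrite integralD// I1 I2 -EFinD; split; first exact: integrableD.
congr EFin; rewrite /step_log.
have -> : `|x - r - x| = r by rewrite addrAC subrr sub0r normrN gtr0_norm.
have -> : `|x + r - x| = r by rewrite addrAC subrr add0r gtr0_norm.
ring.
Qed.

End logarithmic_kernel.

Section step_hilbert.
Context {R : realType} {X : completeNormedModType R[i]}.
Notation leb := (@lebesgue_measure R).
Variables (n : nat) (al be : 'I_n -> R) (v : 'I_n -> X).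
Hypothesis albe : forall j, al j <= be j.

Definition step_fun (y : measurableTypeR R) : X :=
  \sum_j (\1_(`[al j, be j[) y)%:C *: v j.

Definition step_hilbert (w : measurableTypeR R) : X :=
  \sum_j (step_log (al j) (be j) w)%:C *: v j.

(** The logarithms are singular exactly here; this is a finite, hence negligible,
    exceptional set. *)
Definition endpoints : set R := range al `|` range be.

Lemma finite_endpoints : finite_set endpoints.
Proof. by rewrite finite_setU; split; apply: finite_image; exact: finite_finset. Qed.

Lemma truncated_hilbert_step x r : 0 < r ->
    (forall j, r < `|al j - x| /\ r < `|be j - x|) ->
  truncated_hilbert step_fun x r = step_hilbert x.
Proof.
move=> r0 rj; rewrite /truncated_hilbert.
rewrite (_ : (fun y => _) = (fun y : measurableTypeR R =>
    \sum_j (truncated_kernel (al j) (be j) x r y)%:C *: v j)).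
  rewrite bochner_integral_sum => [|j].
    by apply: eq_bigr => j _; have [ra rb] := rj j;
      have [_ ->] := integral_truncated_kernel (albe j) r0 ra rb.
  by have [ra rb] := rj j; have [] := integral_truncated_kernel (albe j) r0 ra rb.
apply/funext => y; rewrite /step_fun /truncated_kernel; case: ifP => rxy.
  rewrite scaler_sumr; apply: eq_bigr => j _.
  rewrite scalerA -rmorphM/= indicE mem_setE in_itv/= andbT.
  by case: (_ <= _ < _); rewrite ?mulr1 ?mulr0.
by rewrite big1// => j _; rewrite andbF scale0r.
Qed.

(** Off the endpoints the truncated integrals are eventually constant as the
    window shrinks. *)
Lemma hilbert_transform_step x : ~ endpoints x ->
  hilbert_transform step_fun x = step_hilbert x.
Proof.
move=> xE; rewrite /hilbert_transform; apply: (cvg_lim (@norm_hausdorff _ X)).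
apply: cvg_near_cst.
have ne (g : 'I_n -> R) : range g `<=` endpoints -> forall j, 0 < `|g j - x|.
  move=> gE j; rewrite normr_gt0 subr_eq0; apply/eqP => gx; apply: xE.
  by rewrite -gx; apply: gE; exists j.
have rj : \forall r \near 0^'+, forall j, r < `|al j - x| /\ r < `|be j - x|.
  apply: filter_forall => j; near=> r; split; near: r.
    by apply: nbhs_right_lt; apply: ne => //; exact: subsetUl.
  by apply: nbhs_right_lt; apply: ne => //; exact: subsetUr.
near=> r; apply: truncated_hilbert_step; first by near: r; exact: nbhs_right_gt.
by near: r.
Unshelve. all: by end_near. Qed.

Lemma simple_step_fun : simple_fun step_fun.
Proof.
pose p (y : measurableTypeR R) : {ffun 'I_n -> bool} := [ffun j => al j <= y < be j].
pose phi (q : {ffun 'I_n -> bool}) : X := \sum_j (q j)%:R%:C *: v j.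
rewrite (_ : step_fun = phi \o p); last first.
  apply/funext => y; rewrite /step_fun /phi /=; apply: eq_bigr => j _.
  by rewrite indicE mem_setE in_itv ffunE.
apply: simple_fun_comp => q.
rewrite (_ : _ @^-1` _ = \big[setI/setT]_j
    (if q j then `[al j, be j[%classic else ~` `[al j, be j[%classic)).
  apply: bigsetI_measurable => j _; case: (q j); first exact: measurable_itv.
  by apply: measurableC; exact: measurable_itv.
rewrite -bigcap_seq; apply/seteqP; split => y /=.
  move=> <- j /= _; rewrite ffunE; case: ifP => /=; rewrite in_itv/=; first by [].
  by move=> ->.
move=> H; apply/ffunP => j; rewrite ffunE.
have /= := H j (mem_index_enum j); case: (q j); rewrite /= in_itv/=; first by [].
by move/negP/negbTE.
Qed.

Lemma measurable_endpoints : measurable (endpoints : set (measurableTypeR R)).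
Proof.
apply: countable_measurable; first exact: measurable_set1.
exact: finite_set_countable finite_endpoints.
Qed.

Lemma measurable_fun_off_endpoints d (S : measurableType d)
    (f : measurableTypeR R -> S) :
  measurable_fun (~` endpoints) f -> measurable_fun setT f.
Proof.
have mE := measurable_endpoints.
rewrite -(setUv endpoints) => mf; apply/measurable_funU => //; first exact: measurableC.
split=> // _ Y mY; apply: countable_measurable; first exact: measurable_set1.
by apply: finite_set_countable; apply: sub_finite_set finite_endpoints; exact: subIsetl.
Qed.

Lemma measurable_rnorm_step_hilbert :
  measurable_fun setT (fun w => rnorm (step_hilbert w)).
Proof.
apply: measurable_fun_off_endpoints; apply: open_continuous_measurable_fun.
  apply: closed_openC; apply: accessible_finite_set_closed.1; last exact: finite_endpoints.
  exact: hausdorff_accessible.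
move=> w; rewrite inE => wE; apply: cvg_rnorm; apply: cvg_combination => j.
have ne (g : 'I_n -> R) : range g `<=` endpoints -> forall j, w != g j.
  by move=> gE i; apply/eqP => gw; apply: wE; rewrite gw; apply: gE; exists i.
have E u : step_log (al j) (be j) u = ln `|u - be j| - ln `|u - al j|.
  by rewrite /step_log (distrC u (be j)) (distrC u (al j)).
under eq_fun do rewrite E; rewrite E.
by apply: cvgB; apply: continuous_ln_dist; apply: ne; [exact: subsetUr|exact: subsetUl].
Qed.

Lemma sqr_norm_integral_step_fun_le (s : R) :
    (forall y, rnorm (step_fun y) <= s) ->
  (sqr_norm_integral leb step_fun <= (s ^+ 2 * \sum_j (be j - al j))%:E)%E.
Proof.
move=> gs; have s0 : 0 <= s by apply: le_trans (gs 0); exact: rnorm_ge0.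
pose f j (y : measurableTypeR R) : \bar R := ((s ^+ 2)%:E * (\1_(`[al j, be j[) y)%:E)%E.
have mf j : measurable_fun setT (f j).
  by apply: measurable_funeM; apply/measurable_EFinP; apply: measurable_indic; exact: measurable_itv.
have f0 j y : (0 <= f j y)%E by rewrite mule_ge0// lee_fin sqr_ge0.
apply: (@le_trans _ _ (\int[leb]_y (\sum_j f j y))%E).
  apply: ge0_le_integral => //.
  - by move=> y _; rewrite lee_fin sqr_ge0.
  - apply/measurable_EFinP; apply: measurable_funX.
    rewrite (_ : (fun y => rnorm _) = (fun y => rnorm (step_fun y - (fun=> 0) y))).
      apply: measurable_rnorm_simpleB; first exact: simple_step_fun.
      have := @simple_fun_comp _ (measurableTypeR R) X unit (fun=> tt) (fun=> 0); apply.
      by move=> q; rewrite preimage_cst; case: ifP.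
    by apply/funext => y; rewrite subr0.
  - exact: emeasurable_sum.
  move=> y _; have [[j yj]|yn] := pselect (exists j, al j <= y < be j).
    rewrite (bigD1 j)//= -[leLHS]adde0 leeD//; last exact: sume_ge0.
    rewrite /f indicE mem_setE in_itv/= yj mule1 lee_fin ler_pXn2r ?nnegrE ?rnorm_ge0//.
  rewrite (_ : step_fun y = 0) ?rnorm0 ?expr0n/= ?sume_ge0//.
  rewrite /step_fun big1// => j _; rewrite indicE mem_setE in_itv/= (_ : _ && _ = false) ?scale0r//.
  by apply/negP => yj; apply: yn; exists j.
rewrite ge0_integral_sum// mulr_sumr -sumEFin lee_sum// => j _.
rewrite ge0_integralZl//; last 2 first.
- by apply/measurable_EFinP; apply: measurable_indic; exact: measurable_itv.
- by rewrite lee_fin sqr_ge0.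
rewrite integral_indic ?setIT; last exact: measurable_itv.
rewrite [leRHS]EFinM lee_wpmul2l ?lee_fin ?sqr_ge0//.
suff : (lebesgue_measure (`[al j, be j[%classic : set R) <= (be j - al j)%:E)%E by [].
rewrite lebesgue_measure_itv/= lte_fin.
  by case: ifP => _; rewrite ?lee_fin ?subr_ge0// EFinB.
exact: measurableT.
Qed.

(** The L^2 bound for the Hilbert transform, applied to a step function whose
    intervals carry vectors of norm at most s, takes a form that involves only
    logarithms. *)
Lemma UMD_step_hilbert (C : R) : (forall f : measurableTypeR R -> X, L2 leb f ->
    {ae leb, forall x, cvg (truncated_hilbert f x r @[r --> 0^'+])} /\
    (sqr_norm_integral leb (hilbert_transform f)
       <= C%:E * sqr_norm_integral leb f)%E) ->
  0 <= C -> forall s : R, (forall y, rnorm (step_fun y) <= s) ->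
  (\int[leb]_w ((rnorm (step_hilbert w)) ^+ 2)%:E
     <= (C * (s ^+ 2 * \sum_j (be j - al j)))%:E)%E.
Proof.
move=> HC C0 s gs.
have gint := sqr_norm_integral_step_fun_le gs.
have [|_ HL2] := HC step_fun.
  split; last exact: le_lt_trans gint (ltry _).
  exists (fun=> step_fun); split; first by move=> _; exact: simple_step_fun.
  by apply: aeW => y; exact: cvg_cst.
rewrite EFinM; apply: le_trans (lee_wpmul2l _ gint); last by rewrite lee_fin.
apply: le_trans HL2; rewrite /sqr_norm_integral.
have mh : measurable_fun setT (fun w => ((rnorm (step_hilbert w)) ^+ 2)%:E : \bar R).
  by apply/measurable_EFinP; apply: measurable_funX; exact: measurable_rnorm_step_hilbert.
rewrite (@ge0_ae_eq_integral _ _ _ leb setT (fun w => ((rnorm (step_hilbert w)) ^+ 2)%:E)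
  (fun w => ((rnorm (hilbert_transform step_fun w)) ^+ 2)%:E))//.
- apply: measurable_fun_off_endpoints.
  apply: (@eq_measurable_fun _ _ _ _ _ (fun w => ((rnorm (step_hilbert w)) ^+ 2)%:E)).
    by move=> w; rewrite inE => wE; rewrite hilbert_transform_step.
  exact: measurable_funTS.
- by move=> w _; rewrite lee_fin sqr_ge0.
- by move=> w _; rewrite lee_fin sqr_ge0.
- exists endpoints; split; first exact: measurable_endpoints.
    apply: countable_lebesgue_measure0; exact: finite_set_countable finite_endpoints.
  move=> w /= H; apply: contrapT => wE; apply: H => _.
  by rewrite hilbert_transform_step.
Qed.

End step_hilbert.

(** * The truncated inverse square and interval packings *)

Section inverse_square.
Context {R : realType}.
Notation leb := (@lebesgue_measure R).
Implicit Types a rho u : R.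

Lemma continuous_inv_sqr a u : u != a -> {for u, continuous (fun w => ((w - a) ^+ 2)^-1)}.
Proof.
move=> ua; apply: (@cvgV _ _ _ _ (fun w => (w - a) ^+ 2)).
  by rewrite expf_neq0// subr_eq0.
by apply: cvgM; (apply: cvgB; [exact: cvg_id|exact: cvg_cst]).
Qed.

Lemma integral_inv_sqr_right a rho : 0 < rho ->
  (\int[leb]_(u in `[(a + rho)%R, +oo[) (((u - a)%R ^+ 2)^-1)%:E = (rho^-1)%:E)%E.
Proof.
move=> rho0; have pos u : a + rho <= u -> 0 < u - a.
  by move=> h; rewrite subr_gt0 (lt_le_trans _ h)// ltrDl.
have dF u : 0 < u - a -> is_derive u 1 (fun w => - (w - a)^-1) (((u - a) ^+ 2)^-1).
  move=> p; have d : is_derive u 1 (fun w => w - a) 1.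
    by rewrite -[X in is_derive _ _ _ X]subr0; apply: is_deriveB.
  have dV : is_derive u 1 (fun w => (w - a)^-1) (- (u - a) ^- 2 * 1).
    by apply: (@is_deriveV _ (fun w => w - a)); rewrite gt_eqF.
  have -> : ((u - a) ^+ 2)^-1 = - (- (u - a) ^- 2 * 1) by rewrite mulr1 opprK.
  exact: is_deriveN.
rewrite (@ge0_continuous_FTC2y _ _ (fun w => - (w - a)^-1) _ 0).
- by rewrite sub0e -EFinN opprK addrAC subrr add0r.
- by move=> u _; rewrite invr_ge0 sqr_ge0.
- apply: continuous_in_subspaceT => u; rewrite inE/= in_itv/= andbT => h.
  by apply: continuous_inv_sqr; rewrite -subr_eq0 gt_eqF// pos.
- rewrite -oppr0; apply: cvgN; apply/gtr0_cvgV0.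
    near=> u; rewrite subr_gt0; near: u; apply: nbhs_pinfty_gt; exact: num_real.
  apply/cvgryPgt => A; near=> u; rewrite ltrBrDr; near: u.
  by apply: nbhs_pinfty_gt; exact: num_real.
- move=> u h; have p : 0 < u - a by apply: pos; exact: ltW.
  by have [] := dF _ p.
- apply: cvg_at_right_filter; apply: cvgN; apply: cvgV.
    by rewrite addrAC subrr add0r gt_eqF.
  by apply: cvgB; [exact: cvg_id|exact: cvg_cst].
- move=> u; rewrite in_itv/= andbT => h; have p : 0 < u - a by apply: pos; exact: ltW.
  by rewrite derive1E; have [_ ->] := dF _ p.
Unshelve. all: by end_near. Qed.

Lemma integral_inv_sqr_left a rho : 0 < rho ->
  (\int[leb]_(u in `]-oo, (a - rho)%R]) (((u - a)%R ^+ 2)^-1)%:E = (rho^-1)%:E)%E.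
Proof.
move=> rho0; rewrite -[a - rho]opprK opprB.
rewrite (@ge0_integration_by_substitutionNy _ (fun u => ((u - a) ^+ 2)^-1)).
- rewrite -(integral_inv_sqr_right (- a) rho0) addrC.
  apply: eq_integral => u _ /=; congr (_^-1%:E).
  by rewrite opprK -opprD sqrrN.
- apply: continuous_in_subspaceT => u; rewrite inE/= in_itv/= => h.
  by apply: continuous_inv_sqr; rewrite lt_eqF// (le_lt_trans h)// opprB ltrBlDr ltrDl.
- by move=> u _; rewrite invr_ge0 sqr_ge0.
Qed.

(** The kernel 1/(u-a)^2 cut off at distance rho from its pole. Its integral
    2/rho serves twice: at the point of evaluation, to sum the contributions of
    distant clusters, and at each cluster, to integrate its cancellation error. *)
Definition far_kernel a rho u : R :=
  if rho <= `|u - a| then ((u - a) ^+ 2)^-1 else 0.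

Lemma far_kernel_ge0 a rho u : 0 <= far_kernel a rho u.
Proof. by rewrite /far_kernel; case: ifP => // _; rewrite invr_ge0 sqr_ge0. Qed.

Lemma far_kernel_split a rho u : 0 < rho -> (far_kernel a rho u)%:E =
  (((fun w => (((w - a)%R ^+ 2)^-1)%:E) \_ `]-oo, (a - rho)%R]) u +
  ((fun w => (((w - a)%R ^+ 2)^-1)%:E) \_ `[(a + rho)%R, +oo[) u)%E.
Proof.
move=> rho0; rewrite /far_kernel !patchE !mem_setE !in_itv/= andbT.
have [ua|au] := leP u (a - rho).
  have ua0 : u - a <= 0 by lra.
  rewrite ler0_norm// ifT; last by lra.
  by rewrite ifF ?adde0//; apply/negP => ?; lra.
have [ua|au'] := leP (a + rho) u.
  by rewrite add0e ifT// ger0_norm; lra.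
by rewrite adde0 ifF//; apply/negP; rewrite ler_normr => /orP[?|?]; lra.
Qed.

Lemma measurable_inv_sqr_patch a (D : set R) : measurable D -> (forall u, D u -> u != a) ->
  measurable_fun setT ((fun w => (((w - a)%R ^+ 2)^-1)%:E) \_ D : measurableTypeR R -> \bar R).
Proof.
move=> mD Da; apply/(measurable_restrictT _ mD)/measurable_EFinP.
have oa : open (~` [set a] : set R) by apply: closed_openC; exact: closed_eq.
apply: (@measurable_funS _ _ _ _ (~` [set a])); first exact: open_measurable.
  by move=> u /Da /eqP.
apply: open_continuous_measurable_fun => // u; rewrite inE => ua.
by apply: continuous_inv_sqr; apply/eqP.
Qed.

Lemma measurable_far_kernel a rho : 0 < rho ->
  measurable_fun setT (far_kernel a rho : measurableTypeR R -> R).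
Proof.
move=> rho0; apply/measurable_EFinP.
rewrite (_ : _ \o _ = (fun u => ((fun w => (((w - a)%R ^+ 2)^-1)%:E) \_ `]-oo, (a - rho)%R]) u +
  ((fun w => (((w - a)%R ^+ 2)^-1)%:E) \_ `[(a + rho)%R, +oo[) u)%E); last first.
  by apply/funext => u /=; rewrite far_kernel_split.
apply: emeasurable_funD; apply: measurable_inv_sqr_patch; try exact: measurable_itv.
  by move=> u /=; rewrite in_itv/= => ?; rewrite lt_eqF//; lra.
by move=> u /=; rewrite in_itv/= andbT => ?; rewrite gt_eqF//; lra.
Qed.

Lemma integral_far_kernel a rho : 0 < rho ->
  (\int[leb]_u (far_kernel a rho u)%:E = (2 / rho)%:E)%E.
Proof.
move=> rho0; under eq_integral do rewrite far_kernel_split//.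
rewrite ge0_integralD//=.
- rewrite -!integral_mkcond integral_inv_sqr_left// integral_inv_sqr_right//.
  by rewrite -EFinD; congr EFin; ring.
- by move=> u _; rewrite patchE; case: ifP => // _; rewrite lee_fin invr_ge0 sqr_ge0.
- apply: measurable_inv_sqr_patch; first exact: measurable_itv.
  by move=> u /=; rewrite in_itv/= => ?; rewrite lt_eqF//; lra.
- by move=> u _; rewrite patchE; case: ifP => // _; rewrite lee_fin invr_ge0 sqr_ge0.
- apply: measurable_inv_sqr_patch; first exact: measurable_itv.
  by move=> u /=; rewrite in_itv/= andbT => ?; rewrite gt_eqF//; lra.
Qed.

End inverse_square.

Section disjoint_intervals.
Context {R : realType}.
Notation leb := (@lebesgue_measure R).
Variables (n : nat) (al len : 'I_n -> R).
Hypothesis len0 : forall j, 0 <= len j.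
Hypothesis disj : forall i j, i != j -> 0 < len i -> 0 < len j ->
  al i + len i <= al j \/ al j + len j <= al i.

Lemma disjoint_interval_unique i j u :
  al i <= u < al i + len i -> al j <= u < al j + len j -> i = j.
Proof.
move=> /andP[i1 i2] /andP[j1 j2]; apply/eqP; apply: contraT => ij.
have li : 0 < len i by lra.
have lj : 0 < len j by lra.
by have [?|?] := disj ij li lj; lra.
Qed.

(** At most one of the intervals contains a given point, so f dominates the sum
    of the step functions of heights w j, and not only each of them. *)
Lemma packing (P : pred 'I_n) (w : 'I_n -> R) (f : measurableTypeR R -> R) :
    measurable_fun setT f -> (forall u, 0 <= f u) -> (forall j, 0 <= w j) ->
    (forall j u, P j -> al j <= u < al j + len j -> w j <= f u) ->
  ((\sum_(j | P j) w j * len j)%:E <= \int[leb]_u (f u)%:E)%E.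
Proof.
move=> mf f0 w0 wf.
pose g j (u : measurableTypeR R) : \bar R :=
  ((w j)%:E * (\1_(`[al j, al j + len j[) u)%:E)%E.
have mg j : measurable_fun setT (g j).
  by apply: measurable_funeM; apply/measurable_EFinP; apply: measurable_indic; exact: measurable_itv.
have g0 j u : (0 <= g j u)%E by rewrite mule_ge0// lee_fin.
have gI j : (\int[leb]_u g j u = (w j * len j)%:E)%E.
  rewrite ge0_integralZl//; last 2 first.
  - by apply/measurable_EFinP; apply: measurable_indic; exact: measurable_itv.
  - by rewrite lee_fin.
  rewrite integral_indic ?setIT; [|exact: measurableT|exact: measurable_itv].
  rewrite EFinM; congr (_ * _)%E.
  suff : lebesgue_measure (`[al j, al j + len j[%classic : set R) = (len j)%:E by [].
  rewrite lebesgue_measure_itv/= lte_fin ltrDl -EFinB addrAC subrr add0r.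
  by case: ltgtP (len0 j) => // <-.
rewrite -big_filter -sumEFin; under eq_bigr do rewrite -gI.
rewrite -ge0_integral_sum//; apply: ge0_le_integral => //.
- by move=> u _; apply: sume_ge0.
- exact: emeasurable_sum.
- exact/measurable_EFinP.
move=> u _; rewrite big_filter.
have [[j [Pj ju]]|nj] := pselect (exists j, P j /\ al j <= u < al j + len j).
  rewrite (bigD1 j)//= big1 ?adde0; last first.
    move=> i /andP[_ ij]; rewrite /g indicE mem_setE in_itv/= (_ : _ && _ = false) ?mule0//.
    by apply/negP => iu; move: ij; rewrite (disjoint_interval_unique iu ju) eqxx.
  by rewrite /g indicE mem_setE in_itv/= ju mule1 lee_fin wf.
rewrite big1 ?lee_fin// => j Pj; rewrite /g indicE mem_setE in_itv/=.
rewrite (_ : _ && _ = false) ?mule0//.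
by apply/negP => ju; apply: nj; exists j.
Qed.

End disjoint_intervals.

(** * Clusters of point masses *)

Section clusters.
Context {R : realType} (n : nat) (t m : 'I_n -> R) (s : R).
Hypotheses (s0 : 0 < s) (m0 : forall k, 0 < m k).

Definition cluster_length (c : 'I_n -> 'I_n) j : R := (\sum_(k | c k == j) m k) / s.

Lemma cluster_length_ge0 c j : 0 <= cluster_length c j.
Proof. by rewrite divr_ge0 ?(ltW s0)// sumr_ge0// => k _; exact/ltW. Qed.

Lemma cluster_length_gt0 c j : 0 < cluster_length c j -> exists k, c k = j.
Proof.
move=> h; apply: contrapT => /forallNP nc; move: h.
by rewrite /cluster_length big_pred0 ?mul0r ?ltxx// => k; apply/eqP/nc.
Qed.

Lemma sum_cluster_length c : \sum_j cluster_length c j = (\sum_k m k) / s.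
Proof.
rewrite /cluster_length -mulr_suml; congr (_ / _).
by rewrite [RHS](partition_big c xpredT).
Qed.

(** Place over each point an interval starting there, of length its weight
    divided by s; whenever two intervals meet, replace them by an interval of the
    added length that starts at the leftmost of the two: it still covers both
    groups of points. *)
Lemma disjoint_clusters : exists (c : 'I_n -> 'I_n) (al : 'I_n -> R),
  (forall k, al (c k) <= t k < al (c k) + cluster_length c (c k)) /\
  (forall i j, i != j -> 0 < cluster_length c i -> 0 < cluster_length c j ->
    al i + cluster_length c i <= al j \/ al j + cluster_length c j <= al i).
Proof.
suff H (c : 'I_n -> 'I_n) (al : 'I_n -> R) :
    (forall k, al (c k) <= t k < al (c k) + cluster_length c (c k)) ->
    exists (c : 'I_n -> 'I_n) (al : 'I_n -> R),
    (forall k, al (c k) <= t k < al (c k) + cluster_length c (c k)) /\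
    (forall i j, i != j -> 0 < cluster_length c i -> 0 < cluster_length c j ->
    al i + cluster_length c i <= al j \/ al j + cluster_length c j <= al i).
  apply: (H id t) => k; rewrite lexx ltrDl /cluster_length (big_pred1 k)//.
  by rewrite divr_gt0.
(* Each merger leaves one cluster fewer. *)
have [N] := ubnP #|[set c k | k : 'I_n]|.
elim: N => // N IH in c al * => cN cov.
have [dj|] := pselect (forall i j, i != j -> 0 < cluster_length c i -> 0 < cluster_length c j ->
    al i + cluster_length c i <= al j \/ al j + cluster_length c j <= al i).
  by exists c, al.
move=> ndj.
have [i [j [ij li lj aij jai]]] : exists i j, [/\ i != j, 0 < cluster_length c i,
    0 < cluster_length c j, al i <= al j & al j < al i + cluster_length c i].
  apply: contrapT => nij; apply: ndj => i j ij li lj.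
  have [aij|/ltW aji] := leP (al i) (al j).
    left; rewrite leNgt; apply/negP => h; apply: nij; exists i, j; split => //.
  right; rewrite leNgt; apply/negP => h; apply: nij; exists j, i; split => //.
  by rewrite eq_sym.
pose c' k := if c k == j then i else c k.
have Li : cluster_length c' i = cluster_length c i + cluster_length c j.
  rewrite /cluster_length -mulrDl; congr (_ / _).
  rewrite (bigID (fun k => c k == j))/= addrC; congr (_ + _).
    apply: eq_bigl => k; rewrite /c'; case: (eqVneq (c k) j) => [->|_].
      by rewrite andbF eq_sym (negbTE ij).
    by rewrite andbT.
  by apply: eq_bigl => k; rewrite /c'; case: (eqVneq (c k) j); rewrite ?eqxx ?andbF.
have Ll l : l != i -> l != j -> cluster_length c' l = cluster_length c l.
  move=> lni lnj; rewrite /cluster_length; congr (_ / _); apply: eq_bigl => k.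
  rewrite /c'; case: (eqVneq (c k) j) => [->|//].
  by rewrite eq_sym (negbTE lni) eq_sym (negbTE lnj).
apply: (IH c' al).
  rewrite ltnS in cN; apply: leq_trans cN; apply: proper_card; apply/properP; split.
    apply/fintype.subsetP => l /imsetP[k _ ->]; rewrite /c'; case: ifP => _; last exact: imset_f.
    by have [k' <-] := cluster_length_gt0 li; exact: imset_f.
  exists j; first by have [k' <-] := cluster_length_gt0 lj; exact: imset_f.
  apply/imsetP => -[k _]; rewrite /c'; case: eqVneq => [_ ji|ckj jck].
    by move: ij; rewrite ji eqxx.
  by move: ckj; rewrite -jck eqxx.
move=> k; have /andP[k1 k2] := cov k; rewrite /c'.
case: (eqVneq (c k) j) => [ckj|ckj].
  by move: k1 k2; rewrite ckj Li => ? ?; apply/andP; split; lra.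
have [cki|cki] := eqVneq (c k) i; last by rewrite Ll// k1.
by move: k1 k2; rewrite cki Li => ? ?; apply/andP; split; lra.
Qed.

End clusters.

(** * Comparison of the Cauchy and Hilbert transforms *)

Section point_masses.
Context {R : realType} {X : completeNormedModType R[i]}.
Notation leb := (@lebesgue_measure R).
Implicit Types (lam w x y xi : R).

(** The Cauchy transform of the measure with point masses a k at t k. *)
Definition cauchy_sum n (t : 'I_n -> R) (a : 'I_n -> X) x y : X :=
  \sum_k ((t k)%:C - (x +i* y))^-1 *: a k.

Lemma cone_kernel_ge lam x y (t : R) : `|x - lam| < y ->
  `|t - lam| <= 2 * rnorm (t%:C - (x +i* y)).
Proof.
move=> xy; have y0 : 0 < y by apply: le_lt_trans xy.
have h1 := rnorm_kernel_ge_Im t x y0; have h2 := rnorm_kernel_ge_Re t x y.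
have h3 : `|t - lam| <= `|t - x| + `|x - lam|.
  by rewrite -[X in `|X|](_ : (t - x) + (x - lam) = _) ?ler_normD// addrA subrK.
by lra.
Qed.

(** Both kernels are of size 1/D at distance D, and their poles z and w differ
    by at most 3y while the sources t and xi differ by at most the cluster
    length: the difference gains a factor (L + 3y)/D. *)
Lemma rnorm_far_kernel_sub lam x y w (t xi D L : R) : `|x - lam| < y -> `|w - lam| < y ->
    D <= 2 * `|t - lam| -> D <= 2 * `|xi - lam| -> 4 * y <= D -> `|xi - t| <= L ->
  rnorm ((t%:C - (x +i* y))^-1 - ((xi - w)^-1)%:C) <= 16 * (L + 3 * y) / D ^+ 2.
Proof.
move=> xlam wlam tD xiD yD xit.
have y0 : 0 < y by apply: le_lt_trans xlam.
have D0 : 0 < D by lra.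
have zD : D / 4 <= rnorm (t%:C - (x +i* y)) by have := cone_kernel_ge t xlam; lra.
have wD : D / 4 <= `|xi - w|.
  have : `|xi - lam| <= `|xi - w| + `|w - lam|.
    exact: ler_distD.
  by lra.
have z0 := kernel_neq0 t x y0.
have w0 : xi - w != 0 by rewrite -normr_gt0; lra.
have wC0 : (xi - w)%:C != 0 :> R[i] by apply: contra_neq w0 => -[].
have -> : (t%:C - (x +i* y))^-1 - ((xi - w)^-1)%:C
    = ((xi - w)%:C - (t%:C - (x +i* y))) * ((t%:C - (x +i* y))^-1 * ((xi - w)%:C)^-1).
  have -> : ((xi - w)^-1)%:C = ((xi - w)%:C)^-1 :> R[i] by exact: fmorphV.
  by move: z0 wC0; generalize (t%:C - (x +i* y)) ((xi - w)%:C : R[i]) => p q p0 q0;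
    field; rewrite p0 q0.
rewrite !rnormCM !rnormV rnorm_real.
have num : rnorm ((xi - w)%:C - (t%:C - (x +i* y))) <= L + 3 * y.
  apply: le_trans (rnorm_le_ReIm _) _ => /=.
  rewrite !sub0r opprK (gtr0_norm y0).
  have : `|xi - w - (t - x)| <= `|xi - t| + `|x - w|.
    by rewrite (_ : xi - w - (t - x) = (xi - t) + (x - w)) ?ler_normD//; ring.
  have : `|x - w| <= `|x - lam| + `|w - lam|.
    by rewrite (distrC w lam) ler_distD.
  by lra.
have den (r : R) : D / 4 <= r -> r^-1 <= 4 / D.
  move=> h; rewrite -[4 / D]invrK lef_pV2 ?posrE ?invr_gt0 ?divr_gt0//; last by lra.
  by rewrite invf_div.
rewrite (_ : 16 * (L + 3 * y) / D ^+ 2 = (L + 3 * y) * (4 / D * (4 / D))); last first.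
  by field; rewrite gt_eqF.
apply: ler_pM => //; first exact: (@rnorm_ge0 R R[i]^o).
  by rewrite mulr_ge0 ?invr_ge0//; lra.
by apply: ler_pM; rewrite ?invr_ge0 ?den//; lra.
Qed.

(** By the mean value theorem the Hilbert transform of a uniform density on the
    interval of a cluster is the total mass times the kernel at some point of that
    interval, so each point mass is compared with one value of the kernel. *)
Lemma rnorm_far_cluster n (t m : 'I_n -> R) (a : 'I_n -> X) (Q : pred 'I_n)
    lam x y w (al L : R) : (forall k, rnorm (a k) <= m k) -> 0 < L ->
    (forall k, Q k -> al <= t k < al + L) ->
    `|x - lam| < y -> `|w - lam| < y -> 2 * L <= `|lam - al| -> 4 * y <= `|lam - al| ->
  rnorm (\sum_(k | Q k) ((t k)%:C - (x +i* y))^-1 *: a k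
     - (step_log al (al + L) w)%:C *: ((L^-1)%:C *: \sum_(k | Q k) a k))
  <= (\sum_(k | Q k) m k) * (16 * (L + 3 * y) / `|lam - al| ^+ 2).
Proof.
move=> am L0 tQ xlam wlam LD yD.
have y0 : 0 < y by apply: le_lt_trans xlam.
have away u : al <= u <= al + L -> `|lam - al| <= 2 * `|u - lam|.
  move=> /andP[u1 u2].
  have : `|lam - al| <= `|u - lam| + `|u - al|.
    by rewrite (distrC u lam) ler_distD.
  by rewrite (ger0_norm (_ : 0 <= u - al)) ?subr_ge0//; lra.
have [||xi /andP[xi1 xi2] ->] := @step_log_mean_value R al (al + L) w.
- by rewrite ltrDl.
- apply/orP; move: wlam; rewrite ltr_norml => /andP[? ?].
  case: (leP al lam) => h; [right|left]; move: LD yD.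
    by rewrite ger0_norm ?subr_ge0// => ? ?; lra.
  by rewrite ltr0_norm ?subr_lt0// => ? ?; lra.
rewrite [al + L - al]addrAC subrr add0r scalerA -rmorphM/= mulrAC mulfV ?gt_eqF// mul1r.
rewrite scaler_sumr -sumrB mulr_suml (le_trans (rnorm_sum _ _ _))// ler_sum// => k Qk.
rewrite -scalerBl rnormZ mulrC ler_pM ?rnorm_ge0//; first exact: (@rnorm_ge0 R R[i]^o).
have /andP[t1 t2] := tQ _ Qk.
apply: (rnorm_far_kernel_sub xlam wlam _ _ yD).
- by apply: away; rewrite t1 ltW.
- by apply: away; rewrite !ltW.
- by rewrite ler_norml; apply/andP; split; lra.
Qed.

Lemma rnorm_near_cluster n (t m : 'I_n -> R) (a : 'I_n -> X) (Q : pred 'I_n) x y :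
    (forall k, rnorm (a k) <= m k) -> 0 < y ->
  rnorm (\sum_(k | Q k) ((t k)%:C - (x +i* y))^-1 *: a k) <= (\sum_(k | Q k) m k) / y.
Proof.
move=> am y0; rewrite mulr_suml (le_trans (rnorm_sum _ _ _))// ler_sum// => k Qk.
rewrite rnormZ mulrC ler_pM ?rnorm_ge0//; first exact: (@rnorm_ge0 R R[i]^o).
rewrite rnormV lef_pV2 ?posrE ?rnorm_kernel_ge_Im//.
exact: lt_le_trans y0 (rnorm_kernel_ge_Im _ _ y0).
Qed.

Section fixed_level.
Variables (n : nat) (t m : 'I_n -> R) (a : 'I_n -> X) (s : R).
Hypotheses (s0 : 0 < s) (m0 : forall k, 0 < m k) (am : forall k, rnorm (a k) <= m k).
Variables (c : 'I_n -> 'I_n) (al : 'I_n -> R).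
Let L := cluster_length m s c.
Hypothesis cov : forall k, al (c k) <= t k < al (c k) + L (c k).
Hypothesis disj : forall i j, i != j -> 0 < L i -> 0 < L j ->
  al i + L i <= al j \/ al j + L j <= al i.

Let L0 j : 0 <= L j. Proof. exact: cluster_length_ge0. Qed.

Let sum_mE j : \sum_(k | c k == j) m k = s * L j.
Proof. by rewrite /L /cluster_length mulrC divfK// gt_eqF. Qed.

(** The mass of a cluster, spread uniformly over its interval; by the choice of
    the lengths its density has norm at most s. *)
Definition cluster_density j : X := ((L j)^-1)%:C *: \sum_(k | c k == j) a k.

Lemma rnorm_cluster_density_le j : rnorm (cluster_density j) <= s.
Proof.
rewrite /cluster_density rnormZ rnorm_real.
have [->|Lj] := eqVneq (L j) 0; first by rewrite invr0 normr0 mul0r ltW.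
have Lj0 : 0 < L j by rewrite lt_neqAle eq_sym Lj L0.
rewrite ger0_norm ?invr_ge0// mulrC ler_pdivrMr// -sum_mE.
by rewrite (le_trans (rnorm_sum _ _ _))// ler_sum.
Qed.

(** [P] selects the clusters; the intervals of the others are made empty. *)
Definition cluster_end (P : pred 'I_n) j : R := if P j then al j + L j else al j.

Lemma cluster_end_ge P j : al j <= cluster_end P j.
Proof. by rewrite /cluster_end; case: ifP; rewrite ?lerDl. Qed.

Lemma rnorm_step_density_le P u : rnorm (step_fun al (cluster_end P) cluster_density u) <= s.
Proof.
have sub j : al j <= u < cluster_end P j -> al j <= u < al j + L j.
  move=> /andP[->]; rewrite /cluster_end; case: ifP => _ //= h.
  by rewrite (lt_le_trans h)// lerDl.
rewrite /step_fun; have [[j ju]|nj] := pselect (exists j, al j <= u < cluster_end P j).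
  rewrite (bigD1 j)//= big1 ?addr0 => [|i ij].
    rewrite indicE mem_setE in_itv/= ju scale1r; exact: rnorm_cluster_density_le.
  rewrite indicE mem_setE in_itv/= (_ : _ && _ = false) ?scale0r//.
  apply/negP => iu; move: ij.
  by rewrite (disjoint_interval_unique disj (sub _ iu) (sub _ ju)) eqxx.
rewrite big1 ?rnorm0 ?ltW// => j _; rewrite indicE mem_setE in_itv/=.
rewrite (_ : _ && _ = false) ?scale0r//.
by apply/negP => ju; apply: nj; exists j.
Qed.

(** Clusters that start within 4 y of lam: for them the kernel 1/(t - z) need not be
    comparable with 1/(t - w) when w ranges over the interval of radius y. *)
Definition near_cluster lam y : pred 'I_n := fun j => `|lam - al j| < 4 * y.

(** An interval that starts within 4 y of lam, with length at most half of that
    distance, lies in the interval of radius 6 y around lam. *)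
Lemma near_clusters_length lam y : 0 < y -> (forall j, 2 * L j <= `|lam - al j|) ->
  \sum_(j | near_cluster lam y j) L j <= 12 * y.
Proof.
move=> y0 lamL; rewrite -lee_fin.
have := @packing R n al L L0 disj (near_cluster lam y) (fun=> 1)
  (\1_(`[lam - 6 * y, lam + 6 * y]) : measurableTypeR R -> R).
under eq_bigr do rewrite mul1r.
have -> : (\int[leb]_u (\1_(`[lam - 6 * y, lam + 6 * y]) u : R)%:E = (12 * y)%:E)%E.
  rewrite integral_indic ?setIT; [|exact: measurableT|exact: measurable_itv].
  suff : lebesgue_measure (`[lam - 6 * y, lam + 6 * y]%classic : set R) = (12 * y)%:E by [].
  rewrite lebesgue_measure_itv/= lte_fin ifT; last by lra.
  by rewrite -EFinB; congr EFin; ring.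
apply=> [||//|]; [by apply: measurable_indic; exact: measurable_itv|by []|].
move=> j u nj /andP[u1 u2]; rewrite indicE mem_setE in_itv/= (_ : _ && _ = true)//.
have := lamL j; move: nj; rewrite /near_cluster ltr_norml => /andP[h1 h2] h3.
have h4 : `|lam - al j| <= 4 * y by rewrite ler_norml; apply/andP; split; lra.
by apply/andP; split; lra.
Qed.

(** On the interval of a far cluster the distance to lam is at least 2 y, and at
    most 3/2 times its value at the left end; so the sum is at most (3/2)^2 times
    the integral of the inverse square of the distance beyond 2 y. *)
Lemma far_clusters_sum lam y : 0 < y -> (forall j, 2 * L j <= `|lam - al j|) ->
  \sum_(j | ~~ near_cluster lam y j) L j / `|lam - al j| ^+ 2 <= 9 / 4 / y.
Proof.
move=> y0 lamL; rewrite -lee_fin.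
have y20 : 0 < 2 * y by rewrite mulr_gt0.
have := @packing R n al L L0 disj (fun j => ~~ near_cluster lam y j)
  (fun j => (`|lam - al j| ^+ 2)^-1) (fun u => 9 / 4 * far_kernel lam (2 * y) u).
under eq_bigr do rewrite mulrC.
have -> : (\int[leb]_u (9 / 4 * far_kernel lam (2 * y) u)%:E = (9 / 4 / y)%:E)%E.
  under eq_integral do rewrite EFinM.
  rewrite ge0_integralZl ?lee_fin ?divr_ge0//; last 2 first.
  - by apply/measurable_EFinP; exact: measurable_far_kernel.
  - by move=> u _; rewrite lee_fin far_kernel_ge0.
  rewrite integral_far_kernel// -EFinM; congr EFin; field.
  by rewrite gt_eqF.
apply.
- by apply: measurable_funM => //; exact: measurable_far_kernel.
- by move=> u; rewrite mulr_ge0 ?far_kernel_ge0// divr_ge0.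
- by move=> j; rewrite invr_ge0 sqr_ge0.
move=> j u; rewrite /near_cluster -leNgt => jy /andP[u1 u2].
have lj := lamL j; have D0 : 0 < `|lam - al j| by lra.
have e1 : `|u - al j| <= L j by rewrite ger0_norm; lra.
have e2 : `|u - lam| <= `|u - al j| + `|lam - al j|.
  by rewrite (distrC lam) ler_distD.
have e3 : `|lam - al j| <= `|u - lam| + `|u - al j|.
  by rewrite (distrC u lam) ler_distD.
rewrite /far_kernel ifT; last by lra.
have u0 : 0 < `|u - lam| by lra.
rewrite -[(u - lam) ^+ 2]real_normK ?num_real// -[9 / 4](_ : (2 / 3) ^- 2 = _); last by field.
rewrite -invfM -exprMn lef_pV2 ?posrE ?exprn_gt0 ?mulr_gt0//.
by rewrite ler_pXn2r ?nnegrE//; lra.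
Qed.

(** The part of the comparison error that is quadratic in the cluster lengths. It
    need not be small at a given lam, but its integral is 16 times the mass. *)
Definition cancellation_bound lam : R :=
  \sum_(j | 0 < L j) 16 * s * L j ^+ 2 * far_kernel (al j) (2 * L j) lam.

Lemma cancellation_term_ge0 j lam :
  0 <= 16 * s * L j ^+ 2 * far_kernel (al j) (2 * L j) lam.
Proof.
apply: mulr_ge0; last exact: far_kernel_ge0.
by apply: mulr_ge0; [apply: mulr_ge0 => //; exact: ltW|exact: sqr_ge0].
Qed.

(** Cotlar-type comparison at one point w of the interval around lam: up to
    O(s) and the cancellation term, the Cauchy transform at (x, y) is the
    Hilbert transform at w of the part of the density away from lam. *)
Lemma rnorm_cauchy_sum_le lam x y w : (forall j, 2 * L j <= `|lam - al j|) ->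
    `|x - lam| < y -> `|w - lam| < y ->
  rnorm (cauchy_sum t a x y) <= 120 * s + cancellation_bound lam
    + rnorm (step_hilbert al (cluster_end xpredT) cluster_density w)
    + rnorm (step_hilbert al (cluster_end (near_cluster lam y)) cluster_density w).
Proof.
move=> lamL xlam wlam; have y0 : 0 < y by apply: le_lt_trans xlam.
set N := near_cluster lam y.
pose T j := \sum_(k | c k == j) ((t k)%:C - (x +i* y))^-1 *: a k.
pose l P j := (step_log (al j) (cluster_end P j) w)%:C *: cluster_density j.
(* The error of a near cluster is its mass s L over y; that of a far one is
   its mass times 16 (L + 3 y) / D^2, with D the distance of its left end to lam. *)
pose e j := if N j then s * L j / y else
  16 * s * (L j ^+ 2 / `|lam - al j| ^+ 2) + 48 * s * y * (L j / `|lam - al j| ^+ 2).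
have FE : cauchy_sum t a x y = \sum_j T j.
  by rewrite /cauchy_sum (partition_big c xpredT).
have -> : cauchy_sum t a x y = \sum_j (T j - l xpredT j + l N j)
    + step_hilbert al (cluster_end xpredT) cluster_density w
    - step_hilbert al (cluster_end N) cluster_density w.
  by rewrite FE big_split sumrB/= /step_hilbert -/(l _ _) addrAC addrK subrK.
rewrite (le_trans (rnormB _ _))// lerD2r (le_trans (rnormD _ _))// lerD2r.
have term j : rnorm (T j - l xpredT j + l N j) <= e j.
  rewrite /l /e /cluster_end/=; case: ifP => Nj.
    by rewrite subrK -sum_mE; exact: rnorm_near_cluster.
  rewrite [step_log (al j) (al j) w]/step_log subrr scale0r addr0.
  have [Lj|Lj] := eqVneq (L j) 0.
    have E (f : 'I_n -> X) : \sum_(k | c k == j) f k = 0.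
      rewrite big_pred0// => k; apply/negP => /eqP ckj.
      have := cov k; rewrite ckj Lj addr0 => /andP[? ?]; lra.
    rewrite /T /cluster_density !E !scaler0 subrr rnorm0 Lj.
    by rewrite expr0n/= !mul0r !mulr0 addr0.
  have Lj0 : 0 < L j by rewrite lt_neqAle eq_sym Lj L0.
  apply: le_trans (@rnorm_far_cluster _ t m a _ lam x y w (al j) (L j) am Lj0 _ xlam wlam (lamL j) _) _.
  - by move=> k /eqP ckj; have := cov k; rewrite ckj.
  - by rewrite leNgt; move: Nj; rewrite /N /near_cluster => ->.
  rewrite sum_mE le_eqVlt; apply/orP; left; apply/eqP; field.
  by rewrite gt_eqF//; have := lamL j; lra.
rewrite (le_trans (rnorm_sum _ _ _))// (le_trans (ler_sum _ (fun j _ => term j)))//.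
(* 12 s comes from the near clusters, and 108 s = 48 s (9/4) from the terms
   linear in the lengths of the far ones. *)
rewrite (bigID N)/= [120 * s](_ : _ = 12 * s + 108 * s); last by ring.
rewrite -addrA lerD//.
  rewrite (eq_bigr (fun j => s / y * L j)) => [|j Nj]; last by rewrite /e Nj mulrAC.
  rewrite -mulr_sumr (le_trans (ler_wpM2l _ (near_clusters_length y0 lamL)))//.
    by rewrite divr_ge0 ?ltW.
  by rewrite (_ : s / y * (12 * y) = 12 * s)//; field; rewrite gt_eqF.
rewrite (eq_bigr (fun j => 16 * s * (L j ^+ 2 / `|lam - al j| ^+ 2)
   + 48 * s * y * (L j / `|lam - al j| ^+ 2))) => [|j /negbTE Nj]; last by rewrite /e Nj.
rewrite big_split/= addrC lerD//.
  rewrite -mulr_sumr (le_trans (ler_wpM2l _ (far_clusters_sum y0 lamL)))//.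
    by rewrite !mulr_ge0 ?ltW.
  by rewrite (_ : 48 * s * y * (9 / 4 / y) = 108 * s)//; field; rewrite gt_eqF.
rewrite /cancellation_bound (bigID (fun j => 0 < L j))/= [X in _ + X]big1 ?addr0; last first.
  move=> j /andP[_]; rewrite lt_neqAle L0 andbT negbK => /eqP <-.
  by rewrite expr0n/= mul0r mulr0.
rewrite [leRHS](bigID N)/= ler_wpDl//.
  by apply: sumr_ge0 => j _; exact: cancellation_term_ge0.
rewrite le_eqVlt; apply/orP; left; apply/eqP; apply: eq_big => [j|j _].
  by rewrite andbC.
rewrite /far_kernel lamL real_normK ?num_real//; ring.
Qed.

End fixed_level.
End point_masses.

(** * The weak-type estimate for point masses *)

Section weak_type.
Context {R : realType} {X : completeNormedModType R[i]}.
Notation leb := (@lebesgue_measure R).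

(** All that is used of the UMD property. *)
Definition step_hilbert_bound (C : R) := forall n (al be : 'I_n -> R) (v : 'I_n -> X),
  (forall j, al j <= be j) -> forall s : R, (forall y, rnorm (step_fun al be v y) <= s) ->
  (\int[leb]_w ((rnorm (step_hilbert al be v w)) ^+ 2)%:E
     <= (C * (s ^+ 2 * \sum_j (be j - al j)))%:E)%E.

Lemma UMD_step_hilbert_bound : UMD X -> exists2 C, 0 <= C & step_hilbert_bound C.
Proof.
move=> [C HC]; exists (Num.max C 0); first by rewrite le_max lexx orbT.
move=> n al be v albe s gs; apply: UMD_step_hilbert => //; last by rewrite le_max lexx orbT.
move=> f fL2; have [cf Cf] := HC f fL2; split => //; apply: (le_trans Cf).
by rewrite lee_wpmul2r ?integral_ge0 ?lee_fin ?le_max ?lexx// => t _; rewrite lee_fin sqr_ge0.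
Qed.

Lemma measure_bigsetU_le (I : Type) (r : seq I) (F : I -> set (measurableTypeR R)) :
  (forall i, measurable (F i)) ->
  (leb (\big[setU/set0]_(i <- r) F i) <= \sum_(i <- r) leb (F i))%E.
Proof.
move=> mF; elim: r => [|i r IH]; first by rewrite !big_nil measure0.
rewrite !big_cons (le_trans (measureU2 _ _ _))//; first exact: bigsetU_measurable.
by rewrite leeD2l.
Qed.

(** The upper level sets of non-tangential maximal functions have this form, and
    they are unions of intervals, hence open. *)
Definition cone_set (P : R -> R -> Prop) : set R :=
  [set lam | exists x y, [/\ 0 < y, `|x - lam| < y & P x y]].

Lemma open_cone_set P : open (cone_set P).
Proof.
rewrite (_ : cone_set P = \bigcup_(p in [set p : R * R | 0 < p.2 /\ P p.1 p.2]) ball p.1 p.2).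
  by apply: bigcup_open => p [p0 _]; exact: ball_open.
apply/seteqP; split => lam.
  by move=> [x [y [y0 xy Pxy]]]; exists (x, y).
by move=> [[x y] /= [y0 Pxy] xy]; exists x, y.
Qed.

Section fixed_level.
Variables (n : nat) (t m : 'I_n -> R) (a : 'I_n -> X) (s C : R).
Hypotheses (s0 : 0 < s) (m0 : forall k, 0 < m k) (am : forall k, rnorm (a k) <= m k).
Hypotheses (C0 : 0 <= C) (CB : step_hilbert_bound C).
Variables (c : 'I_n -> 'I_n) (al : 'I_n -> R).
Let L := cluster_length m s c.
Hypothesis cov : forall k, al (c k) <= t k < al (c k) + L (c k).
Hypothesis disj : forall i j, i != j -> 0 < L i -> 0 < L j ->
  al i + L i <= al j \/ al j + L j <= al i.
Let M := \sum_k m k.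

Let L0 j : 0 <= L j. Proof. exact: cluster_length_ge0. Qed.

Let sumL : \sum_j L j = M / s. Proof. exact: sum_cluster_length. Qed.

Let M0 : 0 <= M. Proof. by apply: sumr_ge0 => k _; exact: ltW. Qed.

Let sqr_hilbert P w : R :=
  rnorm (step_hilbert al (cluster_end m s c al P) (cluster_density m a s c) w) ^+ 2.

Let measurable_sqr_hilbert P :
  measurable_fun setT (sqr_hilbert P : measurableTypeR R -> R).
Proof. by apply: measurable_funX; exact: measurable_rnorm_step_hilbert. Qed.

Let integral_sqr_hilbert P :
  (\int[leb]_w (sqr_hilbert P w)%:E <= (C * (s ^+ 2 * \sum_(j | P j) L j))%:E)%E.
Proof.
rewrite (_ : \sum_(j | P j) L j = \sum_j (cluster_end m s c al P j - al j)).
  apply: CB; first by move=> j; exact: cluster_end_ge.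
  by move=> y; exact: rnorm_step_density_le.
rewrite big_mkcond; apply: eq_bigr => j _; rewrite /cluster_end; case: ifP => _.
  by rewrite addrAC subrr add0r.
by rewrite subrr.
Qed.

(** The comparison holds at every w within y of lam, so its square can be
    averaged over that interval: the near part has average O(s^2) because the near
    clusters have total length O(y), and a large Cauchy transform forces a large
    average of the squared Hilbert transform of the whole density. *)
Lemma cauchy_sum_HL_maximal lam x y : (forall j, 2 * L j <= `|lam - al j|) ->
    cancellation_bound m s c al lam <= s -> `|x - lam| < y ->
    (123 + 3 * C) * s < rnorm (cauchy_sum t a x y) ->
  ((2 * s ^+ 2)%:E < HL_maximal (sqr_hilbert xpredT) lam)%E.
Proof.
move=> lamL bs xlam As; have y0 : 0 < y by apply: le_lt_trans xlam.
set N := near_cluster al lam y.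
(* With p, q the norms of the two Hilbert transforms, p + q is at least the
   Cauchy transform minus 121 s, and p^2 + q^2 >= 2 s (p + q) - 2 s^2. *)
pose kap := 2 * s * (rnorm (cauchy_sum t a x y) - 122 * s).
have kapw w : ball lam y w -> kap <= sqr_hilbert xpredT w + sqr_hilbert N w.
  rewrite /ball/= distrC => wlam.
  have := rnorm_cauchy_sum_le s0 m0 am cov disj lamL xlam wlam.
  rewrite -/N /sqr_hilbert.
  set p := rnorm (step_hilbert _ _ _ _); set q := rnorm (step_hilbert _ _ _ _) => Fpq.
  have h : rnorm (cauchy_sum t a x y) - 122 * s <= p + q - s by lra.
  have s20 : 0 <= 2 * s by rewrite mulr_ge0// ltW.
  have := ler_wpM2l s20 h; have := sqr_ge0 (p - s); have := sqr_ge0 (q - s).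
  by rewrite -/kap; lra.
have mball : measurable (ball lam y : set (measurableTypeR R)).
  by apply: open_measurable; exact: ball_open.
have lball : leb (ball lam y) = (2 * y)%:E.
  suff : lebesgue_measure (ball lam y : set R) = (2 * y)%:E by [].
  by rewrite lebesgue_measure_ball ?ltW// mulr_natl.
have Cs : 0 <= C * s by rewrite mulr_ge0// ltW.
have s20 : 0 < 2 * s by rewrite mulr_gt0.
(* Hence 2 y kap exceeds 4 s^2 y + 12 C s^2 y; the second term is the share of
   the near clusters. *)
have kapl : 2 * s * ((1 + 3 * C) * s) < kap by rewrite /kap ltr_pM2l//; lra.
have kap0 : 0 <= kap.
  by apply: le_trans (ltW kapl); rewrite !mulr_ge0 ?addr_ge0 ?mulr_ge0 ?(ltW s0).
have mS P : measurable_fun (ball lam y) (fun w => (sqr_hilbert P w)%:E : \bar R).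
  by apply/measurable_EFinP; exact: measurable_funTS (measurable_sqr_hilbert P).
have S0 P w : (0 <= (sqr_hilbert P w)%:E)%E by rewrite lee_fin sqr_ge0.
have intN : (\int[leb]_(w in ball lam y) (sqr_hilbert N w)%:E <= (12 * C * s ^+ 2 * y)%:E)%E.
  apply: (@le_trans _ _ (\int[leb]_w (sqr_hilbert N w)%:E)%E).
    by apply: ge0_subset_integral => //; apply/measurable_EFinP.
  apply: (le_trans (integral_sqr_hilbert N)); rewrite lee_fin.
  rewrite (_ : 12 * C * s ^+ 2 * y = C * (s ^+ 2 * (12 * y))); last by ring.
  by rewrite ler_wpM2l// ler_wpM2l ?sqr_ge0//; apply: near_clusters_length.
have low : ((2 * y * kap)%:E <= \int[leb]_(w in ball lam y) (sqr_hilbert xpredT w)%:E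
    + (12 * C * s ^+ 2 * y)%:E)%E.
  apply: le_trans (leeD2l _ intN); rewrite -ge0_integralD//; [|exact: mS|exact: mS].
  have -> : (2 * y * kap)%:E = (\int[leb]_(w in ball lam y) (cst kap%:E w))%E.
    rewrite integral_cst//; transitivity (kap%:E * leb (ball lam y))%E => //.
    by rewrite lball -EFinM mulrC.
  apply: ge0_le_integral => //.
  by apply: emeasurable_funD; exact: mS.
have big : ((4 * s ^+ 2 * y)%:E < \int[leb]_(w in ball lam y) (sqr_hilbert xpredT w)%:E)%E.
  rewrite ltNge; apply/negP => h; have := le_trans low (leeD2r _ h).
  rewrite -EFinD lee_fin leNgt => /negP; apply.
  have y20 : 0 < 2 * y by rewrite mulr_gt0.
  apply: le_lt_trans (_ : _ <= 2 * y * (2 * s * ((1 + 3 * C) * s))) _; last by rewrite ltr_pM2l.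
  by rewrite le_eqVlt; apply/orP; left; apply/eqP; ring.
rewrite /HL_maximal; apply: (@lt_le_trans _ _ (iavg (sqr_hilbert xpredT) (ball lam y))); last first.
  by apply: ereal_sup_ubound; exists y => //=; rewrite in_itv/= y0.
rewrite /iavg lball inver gt_eqF ?mulr_gt0// lte_pdivlMl ?mulr_gt0// -EFinM.
rewrite (_ : 2 * y * (2 * s ^+ 2) = 4 * s ^+ 2 * y); last by ring.
under eq_integral do rewrite gee0_abs//.
exact: big.
Qed.

Let measurable_cancellation :
  measurable_fun setT (cancellation_bound m s c al : measurableTypeR R -> R).
Proof.
rewrite /cancellation_bound.
pose f j (lam : measurableTypeR R) : R :=
  if 0 < L j then 16 * s * L j ^+ 2 * far_kernel (al j) (2 * L j) lam else 0.
rewrite (_ : (fun lam => _) = (fun lam : measurableTypeR R => \sum_j f j lam)); last first.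
  by apply/funext => lam; rewrite big_mkcond.
apply: (@measurable_sum _ (measurableTypeR R) R setT _ _ f) => j.
have [Lj|Lj] := boolP (0 < L j); last first.
  rewrite (_ : f j = cst 0); first exact: measurable_cst.
  by apply/funext => lam; rewrite /f (negbTE Lj).
rewrite (_ : f j = (fun lam => 16 * s * L j ^+ 2 * far_kernel (al j) (2 * L j) lam)); last first.
  by apply/funext => lam; rewrite /f Lj.
by apply: measurable_funM => //; apply: measurable_far_kernel; rewrite mulr_gt0.
Qed.

Let integral_cancellation :
  (\int[leb]_lam (cancellation_bound m s c al lam)%:E = (16 * M)%:E)%E.
Proof.
rewrite /cancellation_bound.
under eq_integral do rewrite -sumEFin -big_filter.
rewrite -/L; rewrite ge0_integral_sum//; last 2 first.
- move=> j; have [Lj|Lj] := ltP 0 (L j).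
    by apply/measurable_EFinP; apply: measurable_funM => //; apply: measurable_far_kernel; rewrite mulr_gt0.
  have -> : (fun x : measurableTypeR R => (16 * s * L j ^+ 2 * far_kernel (al j) (2 * L j) x)%:E) = cst 0%E.
    by apply/funext => x; have -> : L j = 0 by [apply/eqP; rewrite eq_le Lj L0];
      rewrite expr0n/= mulr0 mul0r.
  exact: measurable_cst.
- by move=> j lam _; rewrite lee_fin cancellation_term_ge0.
rewrite big_filter (eq_bigr (fun j => (16 * s * L j)%:E)) => [|j Lj].
  rewrite sumEFin; congr EFin; rewrite -mulr_sumr.
  rewrite -[RHS](_ : 16 * s * (M / s) = _); last by field; rewrite gt_eqF.
  rewrite -sumL; congr (_ * _); rewrite big_mkcond; apply: eq_bigr => j _.
  by case: ltP => // Lj; apply/eqP; rewrite eq_le Lj L0.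
under eq_integral do rewrite EFinM.
rewrite ge0_integralZl//; last 3 first.
- by apply/measurable_EFinP; apply: measurable_far_kernel; rewrite mulr_gt0.
- by move=> lam _; rewrite lee_fin far_kernel_ge0.
- by rewrite lee_fin; apply: mulr_ge0; [apply: mulr_ge0 => //; exact: ltW|exact: sqr_ge0].
have L2 : 0 < 2 * L j by rewrite mulr_gt0.
rewrite integral_far_kernel// -EFinM; congr EFin; field.
by rewrite gt_eqF.
Qed.

(** Three exceptional sets: the doubled intervals, of measure 4 M / s, the points
    with large cancellation error, 16 M / s, and those where the maximal function
    of the squared Hilbert transform is large, 3 C M / (2 s). *)
Lemma cauchy_sum_weak_type_clusters :
  (leb (cone_set (fun x y => ((123 + 3 * C) * s < rnorm (cauchy_sum t a x y))%R))
     <= ((20 + 2 * C) * M / s)%:E)%E.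
Proof.
pose E1 : set (measurableTypeR R) := \big[setU/set0]_j ball (al j) (2 * L j).
pose E2 : set (measurableTypeR R) :=
  setT `&` [set lam | (s%:E <= `|(cancellation_bound m s c al lam)%:E|)%E].
pose E3 : set (measurableTypeR R) :=
  [set lam | ((2 * s ^+ 2)%:E < HL_maximal (sqr_hilbert xpredT) lam)%E].
have mB j : measurable (ball (al j) (2 * L j) : set (measurableTypeR R)).
  exact: measurable_ball.
have mE1 : measurable E1 by exact: bigsetU_measurable.
have mE2 : measurable E2.
  by apply: emeasurable_fun_c_infty => //; apply: measurableT_comp => //; exact/measurable_EFinP.
have intT : (\int[leb]_w (sqr_hilbert xpredT w)%:E <= (C * s * M)%:E)%E.
  apply: (le_trans (integral_sqr_hilbert xpredT)); rewrite lee_fin sumL.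
  by rewrite le_eqVlt; apply/orP; left; apply/eqP; field; rewrite gt_eqF.
have locf : locally_integrable setT (sqr_hilbert xpredT).
  apply: open_integrable_locally; first exact: openT.
  apply/integrableP; split; first exact/measurable_EFinP.
  under eq_integral do rewrite gee0_abs ?lee_fin ?sqr_ge0//.
  exact: le_lt_trans intT (ltry _).
have mE3 : measurable E3.
  rewrite /E3 -[X in measurable X]setTI; apply: emeasurable_fun_o_infty => //.
  exact: measurable_HL_maximal.
have sub : cone_set (fun x y => ((123 + 3 * C) * s < rnorm (cauchy_sum t a x y))%R)
    `<=` E1 `|` E2 `|` E3.
  move=> lam [x [y [y0 xlam Fs]]].
  have [lamE1|lamE1] := pselect (E1 lam); first by left; left.
  have [lamE2|lamE2] := pselect (E2 lam); first by left; right.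
  right; apply: (cauchy_sum_HL_maximal _ _ xlam Fs) => [j|].
    rewrite leNgt; apply/negP => h; apply: lamE1.
    rewrite /E1 -bigcup_seq; exists j; first by rewrite /= mem_index_enum.
    by rewrite /ball/= distrC.
  rewrite leNgt; apply/negP => h; apply: lamE2; split => //=.
  by rewrite lee_fin ltW// (lt_le_trans h)// ler_norm.
have m1 : (leb E1 <= (4 * M / s)%:E)%E.
  apply: (le_trans (measure_bigsetU_le _ mB)).
  rewrite -mulrA -sumL mulr_sumr -sumEFin; apply: lee_sum => j _.
  suff -> : leb (ball (al j) (2 * L j)) = (4 * L j)%:E by [].
  transitivity ((2 * L j) *+ 2)%:E; last by congr EFin; rewrite -mulr_natl; ring.
  by apply: lebesgue_measure_ball; rewrite mulr_ge0.
have m2 : (leb E2 <= (16 * M / s)%:E)%E.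
  have := @le_integral_abse _ (measurableTypeR R) R leb setT measurableT
    (fun lam => (cancellation_bound m s c al lam)%:E) s.
  move=> /(_ _ s0); rewrite -/E2.
  under eq_integral => lam _.
    rewrite gee0_abs; last first.
      by rewrite lee_fin; apply: sumr_ge0 => j _; exact: cancellation_term_ge0.
    over.
  rewrite integral_cancellation => H.
  have {}H : (s%:E * leb E2 <= (16 * M)%:E)%E by apply: H; exact/measurable_EFinP.
  by rewrite [X in X%:E]mulrC EFinM lee_pdivlMl.
have m3 : (leb E3 <= (2 * C * M / s)%:E)%E.
  have s20 : 0 < 2 * s ^+ 2 by rewrite mulr_gt0// exprn_gt0.
  apply: (le_trans (maximal_inequality locf s20)).
  under eq_integral do rewrite gee0_abs ?lee_fin ?sqr_ge0//.
  have s3 : (0 <= (3 / (2 * s ^+ 2))%:E :> \bar R)%E by rewrite lee_fin divr_ge0// ltW.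
  apply: (le_trans (lee_wpmul2l s3 intT)); rewrite -EFinM lee_fin.
  rewrite (_ : 3 / (2 * s ^+ 2) * (C * s * M) = 3 / 2 * (C * M / s)); last first.
    by field; rewrite gt_eqF.
  rewrite -!mulrA [leRHS]mulrA.
  have : 0 <= C * (M / s) by rewrite mulr_ge0// divr_ge0// ltW.
  rewrite -[2 * C * _]mulrA; lra.
apply: (@le_trans _ _ (leb (E1 `|` E2 `|` E3))).
  rewrite le_measure ?inE//; last by apply: measurableU => //; exact: measurableU.
  by apply: open_measurable; exact: open_cone_set.
apply: (le_trans (measureU2 _ _ _)) => //; first exact: measurableU.
apply: (le_trans (leeD (measureU2 _ mE1 mE2) (lexx _))).
apply: (le_trans (leeD (leeD m1 m2) m3)); rewrite -!EFinD lee_fin.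
by rewrite le_eqVlt; apply/orP; left; apply/eqP; field; rewrite gt_eqF.
Qed.

End fixed_level.

(** The masses m are allowed to exceed the norms of the vectors, since the
    clusters need positive masses while some of the vectors may vanish. *)
Lemma cauchy_sum_weak_type n (t m : 'I_n -> R) (a : 'I_n -> X) (s C : R) :
    0 < s -> (forall k, 0 < m k) -> (forall k, rnorm (a k) <= m k) ->
    0 <= C -> step_hilbert_bound C ->
  (leb (cone_set (fun x y => ((123 + 3 * C) * s < rnorm (cauchy_sum t a x y))%R))
     <= ((20 + 2 * C) * (\sum_k m k) / s)%:E)%E.
Proof.
move=> s0 m0 am C0 CB; have [c [al [cov disj]]] := disjoint_clusters t s0 m0.
exact: (cauchy_sum_weak_type_clusters s0 m0 am C0 CB cov disj).
Qed.

End weak_type.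

(** * Passage from point masses to measures *)

Section discretization_limit.
Context {R : realType} {X : completeNormedModType R[i]}.
Notation leb := (@lebesgue_measure R).
Variable mu : set (measurableTypeR R) -> X.
Implicit Types s : R.

Lemma nontangential_max_gt s : [set lam | (s%:E < nontangential_max mu lam)%E] =
  cone_set (fun x y => s < rnorm (cauchy_transform mu (x +i* y))).
Proof.
apply/seteqP; split => lam /=.
  move=> /ereal_sup_gt[_ [x [y [y0 xlam ->]]]]; rewrite lte_fin => h.
  by exists x, y.
move=> [x [y [y0 xlam h]]]; apply: (@lt_le_trans _ _ (rnorm (cauchy_transform mu (x +i* y)))%:E).
  by rewrite lte_fin.
by apply: ereal_sup_ubound; exists x, y.
Qed.

Lemma measurable_nontangential_max : measurable_fun setT (nontangential_max mu).
Proof.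
apply: lower_semicontinuous_measurable; apply/lower_semicontinuousP => s.
by rewrite nontangential_max_gt; exact: open_cone_set.
Qed.

Lemma nontangential_max_ge0 lam : (0 <= nontangential_max mu lam)%E.
Proof.
apply: (@le_trans _ _ (rnorm (cauchy_transform mu (lam +i* 1)))%:E).
  by rewrite lee_fin rnorm_ge0.
by apply: ereal_sup_ubound; exists lam, 1; split => //; rewrite subrr normr0.
Qed.

Lemma measure_variation_ge0 : (0 <= measure_variation mu)%E.
Proof.
apply: ereal_sup_ubound; exists 0, (fun=> set0); split; try by case.
by rewrite big_ord0.
Qed.

(** A point in the cone set of the Cauchy transform lies in those of its grid
    approximations from some rank on, so the bound passes to the limit by
    continuity of the measure along increasing sequences. *)
Lemma cauchy_transform_weak_type (C : R) s : 0 <= C -> @step_hilbert_bound R X C ->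
    vector_measure mu -> (measure_variation mu < +oo)%E -> 0 < s ->
  (s%:E * leb [set lam | (s%:E < nontangential_max mu lam)%E]
    <= ((20 + 2 * C) * (123 + 3 * C))%:E * measure_variation mu)%E.
Proof.
move=> C0 CB muV muoo s0.
have [V VE] : exists V, measure_variation mu = V%:E.
  exists (fine (measure_variation mu)); rewrite fineK// ge0_fin_numE//.
  exact: measure_variation_ge0.
rewrite VE -EFinM -lee_pdivlMl// -EFinM nontangential_max_gt.
set K := (20 + 2 * C) * (123 + 3 * C).
have muM : (measure_variation mu <= V%:E)%E by rewrite VE.
pose P n x y := s < rnorm (cauchy_sum (grid_point n : 'I_(grid_size n) -> R)
  (fun k => mu (grid_cell n k)) x y).
have leP n : (leb (cone_set (P n)) <= (s^-1 * (K * V))%:E)%E.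
  apply/lee_addgt0Pr => e e0; rewrite -EFinD.
  have A0 : 0 < 123 + 3 * C by rewrite ltr_pwDl// mulr_ge0.
  have B0 : 0 < 20 + 2 * C by rewrite ltr_pwDl// mulr_ge0.
  have g0 : 0 < (grid_size n)%:R :> R by rewrite ltr0n.
  (* The masses exceed the norms by eta in total, which costs exactly e. *)
  pose eta : R := e * s / K.
  have eta0 : 0 < eta by rewrite divr_gt0 ?mulr_gt0.
  pose m (k : 'I_(grid_size n)) := rnorm (mu (grid_cell n k)) + eta / (grid_size n)%:R.
  have s'0 : 0 < s / (123 + 3 * C) by rewrite divr_gt0.
  have m0 k : 0 < m k by rewrite ltr_wpDl ?rnorm_ge0// divr_gt0.
  have am (k : 'I_(grid_size n)) : rnorm (mu (grid_cell n k)) <= m k by rewrite lerDl ltW// divr_gt0.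
  have := cauchy_sum_weak_type (grid_point n) s'0 m0 am C0 CB.
  rewrite [(123 + 3 * C) * _]mulrC divfK ?gt_eqF// => /le_trans; apply.
  have mV : \sum_k m k <= V + eta.
    rewrite big_split/= sumr_const card_ord -(mulr_natr (eta / _)) divfK ?gt_eqF// lerD2r.
    by rewrite -lee_fin -VE; exact: grid_variation_le.
  rewrite lee_fin invf_div.
  have -> : s^-1 * (K * V) + e = (20 + 2 * C) * (V + eta) * ((123 + 3 * C) / s).
    by rewrite /eta /K; field; rewrite !gt_eqF.
  by rewrite ler_wpM2r ?divr_ge0 ?(ltW A0) ?(ltW s0)// ler_wpM2l// ltW.
pose W N : set (measurableTypeR R) := \bigcap_(n in [set n | (N <= n)%N]) cone_set (P n).
have mP n : measurable (cone_set (P n) : set (measurableTypeR R)).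
  by apply: open_measurable; exact: open_cone_set.
have mW N : measurable (W N).
  apply: bigcap_measurable => [|n _]; last exact: mP.
  by exists N => /=.
have ndW : nondecreasing_seq W.
  by move=> N N' NN'; apply/subsetPset => lam h n /= N'n; apply: h; exact: leq_trans N'n.
have mUW : measurable (\bigcup_N W N) by exact: bigcupT_measurable.
apply: (@le_trans _ _ (leb (\bigcup_N W N))).
  rewrite le_measure ?inE//; first by apply: open_measurable; exact: open_cone_set.
  move=> lam [x [y [y0 xlam h]]].
  have [N _ HN] : \forall n \near \oo, P n x y.
    apply: (cvgr_gt _ _ _ h); apply: cvg_rnorm; exact: (cauchy_transform_grid muV muM y0).
  by exists N => // n /= Nn; exists x, y; split => //; exact: HN.
have cW := nondecreasing_cvg_mu (mu := leb) mW mUW ndW.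
apply: (cvge_to_le cW); apply: nearW => N /=; apply: le_trans (leP N).
by rewrite le_measure ?inE// => lam; apply => /=.
Qed.

End discretization_limit.

Theorem theorem1p10 (R : realType) (X : completeNormedModType R[i])
    (X_UMD : UMD X) :
  exists C : R, forall mu : set (measurableTypeR R) -> X,
    vector_measure mu -> (measure_variation mu < +oo)%E ->
    weak_L1 (nontangential_max mu) /\
    (ereal_sup [set (s%:E * lebesgue_measure
                       [set lambda | s%:E < nontangential_max mu lambda])%E
               | s in [set s : R | (0 < s)%R]]
       <= C%:E * measure_variation mu)%E.
Proof.
have [C C0 CB] := UMD_step_hilbert_bound X_UMD.
exists ((20 + 2 * C) * (123 + 3 * C)) => mu muV muoo.
have weak : (ereal_sup [set (s%:E * lebesgue_measure
      [set lambda | s%:E < nontangential_max mu lambda])%E | s in [set s : R | (0 < s)%R]]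
    <= ((20 + 2 * C) * (123 + 3 * C))%:E * measure_variation mu)%E.
  by apply: ge_ereal_sup => _ [s s0 <-]; exact: cauchy_transform_weak_type.
split => //; split; first exact: measurable_nontangential_max.
apply: (@le_lt_trans _ _ (((20 + 2 * C) * (123 + 3 * C))%:E * measure_variation mu)%E).
  apply: le_trans weak; apply: ge_ereal_sup => _ [s s0 <-].
  apply: ereal_sup_ubound; exists s => //.
  congr (_ * lebesgue_measure _)%E; apply/seteqP; split => lam /=;
  by rewrite gee0_abs// nontangential_max_ge0.
rewrite -(fineK (_ : measure_variation mu \is a fin_num)) -?EFinM ?ltry//.
by rewrite ge0_fin_numE// measure_variation_ge0.
Qed.
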